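(* There is an algorithm that, given any temporal graph $(G,\tau)$ with lifetime $\Lambda$, decides whether $(G,\tau)$ is a yes-instance of $\mathrm{TempEuler}(k)$ (i.e. whether it is temporally Eulerian) in time $\mathcal{O}(w^3 2^w\Lambda)$, where $w=\mathrm{imw}(G,\tau)$.
   Context: A temporal graph is a pair $(G,\tau)$ where $G$ is a finite simple graph and $\tau: E(G)\to 2^{\mathbb{N}}$ assigns to each edge $e$ a finite set $\tau(e)$ of times at which $e$ is active; a pair $(e,t)$ with $t\in\tau(e)$ is a time-edge. The lifetime is $\Lambda=\max_{e\in E(G)}\max\tau(e)$. A (strict) temporal $(x,y)$-walk is a sequence $(e_1,t_1),\dots,(e_n,t_n)$ of time-edges such that $e_1,\dots,e_n$ is a walk in $G$ from $x$ to $y$ and $t_1<\dots<t_n$; it is closed if $x=y$. A temporal Eulerian circuit is a closed temporal walk $(e_1,t_1),\dots,(e_m,t_m)$ such that $e_1,\dots,e_m$ is an Euler circuit of $G$; $(G,\tau)$ is temporally Eulerian if it has one. $\mathrm{TempEuler}(k)$: given $(G,\tau)$ with $|\tau(e)|\le k$ for all $e$, decide whether $(G,\tau)$ is temporally Eulerian. The interval-membership sequence is $(F_t)_{t\in[\Lambda]}$ with $F_t=\{e\in E(G):\min\tau(e)\le t\le\max\tau(e)\}$, and $\mathrm{imw}(G,\tau)=\max_t|F_t|$. *)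

(* Defs.v *)
From HB Require Import structures.
From mathcomp Require Import all_boot.
From mathcomp Require Import finmap.

Set Implicit Arguments.
Unset Strict Implicit.
Unset Printing Implicit Defensive.

(* Edges are the two-element vertex sets in [edges].  Times are positive, since
   the interval-membership sequence is indexed by {1, ..., lifetime}, and every
   edge is active at least once, since min and max of its set of times are
   taken.  The values of [times] outside [edges] are never used. *)
Record temporal_graph (V : finType) := TemporalGraph {
  edges : {set {set V}};
  times : {set V} -> {fset nat};
  edges_card2 : forall e, e \in edges -> #|e| = 2;
  times_neq0 : forall e, e \in edges -> times e != fset0;
  times_gt0 : forall e t, e \in edges -> t \in times e -> 0 < t
}.

Section TemporalGraph.
Variables (V : finType) (G : temporal_graph V).

Fixpoint walk (x y : V) (es : seq {set V}) : Prop :=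
  match es with
  | [::] => x = y
  | e :: es' =>
      exists z, [/\ e \in edges G, e = [set x; z] & walk z y es']
  end.

Definition euler_circuit (es : seq {set V}) : Prop :=
  [/\ exists x, walk x x es, uniq es & es =i edges G].

Definition time_edge (p : {set V} * nat) : bool :=
  (p.1 \in edges G) && (p.2 \in times G p.1).

Definition temporal_walk (x y : V) (s : seq ({set V} * nat)) : Prop :=
  [/\ all time_edge s, walk x y (unzip1 s) & sorted ltn (unzip2 s)].

Definition temporal_euler_circuit (s : seq ({set V} * nat)) : Prop :=
  (exists x, temporal_walk x x s) /\ euler_circuit (unzip1 s).

Definition temporally_eulerian : Prop := exists s, temporal_euler_circuit s.

Definition max_time (e : {set V}) : nat := \max_(t <- times G e) t.

(* The default value [max_time e] is reached only if [times G e] is empty. *)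
Definition min_time (e : {set V}) : nat :=
  \big[minn/max_time e]_(t <- times G e) t.

Definition lifetime : nat := \max_(e in edges G) max_time e.

Definition interval_members (t : nat) : {set {set V}} :=
  [set e in edges G | min_time e <= t <= max_time e].

Definition imw : nat := \max_(1 <= t < lifetime.+1) #|interval_members t|.

Definition TempEuler_instance (k : nat) : Prop :=
  forall e, e \in edges G -> #|` times G e| <= k.

Definition TempEuler_yes (k : nat) : Prop :=
  TempEuler_instance k /\ temporally_eulerian.

(* A temporal graph is given to an algorithm as the list of numbers
     |V|, |E|, u_1, v_1, k_1, t_11, ..., t_1k_1, u_2, v_2, k_2, ...
   with one block per edge: the labels in {0, ..., |V|-1} of its two ends, the
   number of its times, and its times.  The labelling of the vertices, the order
   of the edges, the order of the two ends of an edge and the order of the times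
   are arbitrary. *)
Definition edge_code (label : V -> 'I_#|V|) (b : V * V * seq nat) : seq nat :=
  [:: val (label b.1.1), val (label b.1.2), size b.2 & b.2].

Definition encodes (inp : seq nat) : Prop :=
  exists (label : V -> 'I_#|V|) (bs : seq (V * V * seq nat)),
    [/\ injective label,
        perm_eq [seq [set b.1.1; b.1.2] | b <- bs] (enum (edges G)),
        forall b, b \in bs -> perm_eq b.2 (times G [set b.1.1; b.1.2])
      & inp = [:: #|V|, size bs & flatten (map (edge_code label) bs)]].

End TemporalGraph.

(* The uniform-cost random access machine, with addition and truncated
   subtraction as only arithmetic, in structured form.  The memory is split into
   arrays named by numbers; array names are literals, so a program has finitely
   many arrays, and with K of them cell i of array a stands for the address
   a + K * i of a single memory.  Registers are cells with a constant index. *)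
Inductive expr : Type :=
  | Const of nat
  | Read of nat & expr
  | Add of expr & expr
  | Sub of expr & expr.

Inductive prog : Type :=
  | Skip
  | Write of nat & expr & expr
  | Seq of prog & prog
  | If of expr & prog & prog
  | While of expr & prog.

Definition memory := nat -> nat -> nat.

Definition update (m : memory) (a i v : nat) : memory :=
  fun b j => if (b == a) && (j == i) then v else m b j.

Fixpoint eval (m : memory) (e : expr) : nat :=
  match e with
  | Const n => n
  | Read a e1 => m a (eval m e1)
  | Add e1 e2 => eval m e1 + eval m e2
  | Sub e1 e2 => eval m e1 - eval m e2
  end.

Fixpoint eval_cost (e : expr) : nat :=
  match e with
  | Const _ => 1
  | Read _ e1 => (eval_cost e1).+1
  | Add e1 e2 | Sub e1 e2 => (eval_cost e1 + eval_cost e2).+1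
  end.

(* [exec p m c m'] : started in memory m, the program p halts in memory m' after
   c elementary steps.  A test succeeds when its value is nonzero. *)
Inductive exec : prog -> memory -> nat -> memory -> Prop :=
  | exec_skip m : exec Skip m 1 m
  | exec_write a ei ev m :
      exec (Write a ei ev) m (eval_cost ei + eval_cost ev).+1
        (update m a (eval m ei) (eval m ev))
  | exec_seq p1 p2 m m1 m2 c1 c2 :
      exec p1 m c1 m1 -> exec p2 m1 c2 m2 ->
      exec (Seq p1 p2) m (c1 + c2).+1 m2
  | exec_if_true e p1 p2 m m' c :
      eval m e != 0 -> exec p1 m c m' ->
      exec (If e p1 p2) m (eval_cost e + c).+1 m'
  | exec_if_false e p1 p2 m m' c :
      eval m e = 0 -> exec p2 m c m' ->
      exec (If e p1 p2) m (eval_cost e + c).+1 m'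
  | exec_while_true e p m m1 m2 c1 c2 :
      eval m e != 0 -> exec p m c1 m1 -> exec (While e p) m1 c2 m2 ->
      exec (While e p) m (eval_cost e + c1 + c2).+1 m2
  | exec_while_false e p m :
      eval m e = 0 -> exec (While e p) m (eval_cost e).+1 m.

Lemma exec_det p m c1 m1 c2 m2 :
  exec p m c1 m1 -> exec p m c2 m2 -> c1 = c2 /\ m1 = m2.
Proof.
move=> H; elim: H c2 m2 => {p m c1 m1};
  intros; match goal with H : exec _ _ ?c ?m |- _ = ?c /\ _ = ?m =>
    inversion H; subst end;
  repeat match goal with
  | IH : forall c m', exec ?p ?m c m' -> _, H : exec ?p ?m _ _ |- _ =>
      case: (IH _ _ H) => ? ?; subst; clear IH
  | H0 : is_true (eval ?m ?e != 0), H1 : eval ?m ?e = 0 |- _ =>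
      by rewrite H1 in H0
  end; by [].
Qed.

Definition input_memory (inp : seq nat) : memory :=
  fun a i => if a == 0 then nth 0 inp i else 0.

Definition output (m : memory) : nat := m 1 0.

(* Main.v *)
Require Import Defs.
From mathcomp Require Import all_boot.
From mathcomp Require Import finmap zify.

Set Implicit Arguments.
Unset Strict Implicit.
Unset Printing Implicit Defensive.

(* Dynamic programming over time, once for every possible start vertex.  In a
   trail, the start and the set of used edges determine the end, because every
   other vertex has even degree in that set.  So after time t it suffices to
   know, for each edge set containing every expired edge and no edge that has
   not yet appeared, whether a trail uses exactly this set, and where it ends.
   Such a set is determined by its trace on the edges alive at t, which leaves
   at most 2^w candidates, and each is updated in O(w) steps by trying every
   alive edge as the last one.  The first edge of a circuit is used no later
   than the first expiry of an edge and expires no earlier, so it is alive at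
   that moment, and there are at most 2w start vertices.

   A set of edges is addressed in memory by the number whose binary digits are
   its indicator, so one array over all such numbers holds the table.  Entries
   are valid only if they carry the stamp of the current stage, so that the
   table never has to be cleared. *)

(** * Cost-bounded weakest preconditions *)

(** Neither the number of vertices nor the input length occurs in the bound, so no loop runs over
    vertices, and reading the input is charged to the pairs of an edge and a time in its interval.
    There are at most [w] such pairs per time, hence at most [w] times the lifetime in all; building
    the lists of alive edges fits the same budget. Addressing the table by whole edge sets, and not
    by masks of the alive edges, means that a surviving entry keeps its address when the alive edges
    change. The addresses have one digit per edge of the graph; the uniform cost model makes them
    affordable, and as the machine only adds and subtracts, powers of two come from doubling and
    digits from comparisons. Two starts per first edge, one stage per time, [2^w] masks and [O(w)]
    steps per mask give order [w^2 2^w] times the lifetime, within the claimed bound. *)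

Fixpoint writes (p : prog) : seq nat :=
  match p with
  | Skip => [::]
  | Write a _ _ => [:: a]
  | Seq p q | If _ p q => writes p ++ writes q
  | While _ p => writes p
  end.

Lemma update_neq m a i v b : b != a -> update m a i v b = m b.
Proof. by rewrite /update => /negPf ->. Qed.

Lemma update_eq m a i v : update m a i v a i = v.
Proof. by rewrite /update !eqxx. Qed.

Lemma update_at m a i v j :
  update m a i v a j = if j == i then v else m a j.
Proof. by rewrite /update eqxx. Qed.

Lemma exec_frame p m c m' a : exec p m c m' -> a \notin writes p -> m' a = m a.
Proof.
elim=> {p m c m'} //=.
- by move=> b ei ev m; rewrite inE; apply: update_neq.
- move=> p q m m1 m2 c1 c2 _ IH1 _ IH2; rewrite mem_cat negb_or => /andP[h1 h2].
  by rewrite IH2 ?IH1.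
- move=> e p q m m' c _ _ IH; rewrite mem_cat negb_or => /andP[h1 h2].
  exact: IH.
- move=> e p q m m' c _ _ IH; rewrite mem_cat negb_or => /andP[h1 h2].
  exact: IH.
- by move=> e p m m1 m2 c1 c2 _ _ IH1 _ IH2 h; rewrite IH2 ?IH1.
Qed.

(** Total correctness with a cost bound. Asking for some run is enough, since [exec_det] makes it
    the only one. *)
Definition wp (p : prog) (m : memory) (K : nat) (Q : memory -> Prop) : Prop :=
  exists c m', [/\ exec p m c m', c <= K & Q m'].

(** The frame condition handed to the continuation carries unwritten arrays past a program without
    mentioning them in its postcondition. *)
Lemma wp_weaken p m K K' (Q Q' : memory -> Prop) :
  wp p m K Q -> K <= K' ->
  (forall m', (forall a, a \notin writes p -> m' a = m a) -> Q m' -> Q' m') ->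
  wp p m K' Q'.
Proof.
move=> [c [m' [ex le q]]] leK imp; exists c, m'; split=> //.
  exact: leq_trans leK.
by apply: imp q => a; apply: exec_frame ex.
Qed.

Lemma wp_seq p q m K1 K2 K (Q : memory -> Prop) :
  wp p m K1 (fun m1 => wp q m1 K2 Q) -> K1 + K2 < K -> wp (Seq p q) m K Q.
Proof.
move=> [c1 [m1 [e1 l1 [c2 [m2 [e2 l2 q2]]]]]] lt.
exists (c1 + c2).+1, m2; split=> //; first exact: exec_seq e1 e2.
by apply: leq_ltn_trans lt; apply: leq_add.
Qed.

(** Induction on the number of iterations left. The cost may vary with the iteration because the
    parser charges each edge the length of its own interval. *)
Lemma wp_while e p (n : nat) (I : nat -> memory -> Prop) (B : nat -> nat) m K
    (Q : memory -> Prop) :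
  I 0 m ->
  (forall i m', i < n -> (forall a, a \notin writes p -> m' a = m a) ->
     I i m' -> eval m' e != 0 /\ wp p m' (B i) (I i.+1)) ->
  (forall m', (forall a, a \notin writes p -> m' a = m a) -> I n m' ->
     eval m' e = 0 /\ Q m') ->
  \sum_(i < n) (B i + eval_cost e + 1) + eval_cost e < K ->
  wp (While e p) m K Q.
Proof.
move=> I0 step stop leK.
suff H j : j <= n -> forall m',
    (forall a, a \notin writes p -> m' a = m a) -> I (n - j) m' ->
    wp (While e p) m'
      (\sum_(n - j <= i < n) (B i + eval_cost e + 1) + eval_cost e).+1 Q.
  have := H n (leqnn n) m (fun _ _ => erefl); rewrite subnn big_mkord => H'.
  by apply: wp_weaken (H' I0) leK _.
elim: j => [_ m' fr Im'|j IH lt m' fr Im'].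
  rewrite subn0 in Im' *.
  have [e0 q] := stop _ fr Im'.
  exists (eval_cost e).+1, m'; split=> //; first exact: exec_while_false.
  by rewrite big_geq.
have lt' : n - j.+1 < n by lia.
have [ne [c1 [m1 [e1 l1 q1]]]] := step _ _ lt' fr Im'.
have eqs : (n - j.+1).+1 = n - j by lia.
rewrite eqs in q1.
have fr1 a : a \notin writes p -> m1 a = m a.
  by move=> ha; rewrite (exec_frame e1 ha) fr.
have [c2 [m2 [e2 l2 q2]]] := IH (ltnW lt) _ fr1 q1.
exists (eval_cost e + c1 + c2).+1, m2; split=> //.
  exact: exec_while_true e1 e2.
rewrite big_ltn // eqs; move: l1 l2.
by set s := \sum_(_ <= _ < _) _; lia.
Qed.

Lemma wp_while_const e p (n : nat) (I : nat -> memory -> Prop) (B : nat) m K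
    (Q : memory -> Prop) :
  I 0 m ->
  (forall i m', i < n -> (forall a, a \notin writes p -> m' a = m a) ->
     I i m' -> eval m' e != 0 /\ wp p m' B (I i.+1)) ->
  (forall m', (forall a, a \notin writes p -> m' a = m a) -> I n m' ->
     eval m' e = 0 /\ Q m') ->
  n * (B + eval_cost e + 1) + eval_cost e < K ->
  wp (While e p) m K Q.
Proof.
move=> I0 step stop leK; apply: (wp_while (B := fun=> B) I0 step stop).
by rewrite sum_nat_const card_ord.
Qed.

Fixpoint flat (p : prog) : bool :=
  match p with
  | Skip | Write _ _ _ => true
  | Seq p q | If _ p q => flat p && flat q
  | While _ _ => false
  end.

Fixpoint sem (p : prog) (m : memory) : memory :=
  match p with
  | Skip => m
  | Write a ei ev => update m a (eval m ei) (eval m ev)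
  | Seq p q => sem q (sem p m)
  | If e p q => if eval m e == 0 then sem q m else sem p m
  | While _ _ => m
  end.

(** Both branches of a test are charged, which keeps the bound independent of the memory and costs
    only a constant factor on loop-free pieces. *)
Fixpoint bound (p : prog) : nat :=
  match p with
  | Skip => 1
  | Write _ ei ev => (eval_cost ei + eval_cost ev).+1
  | Seq p q => (bound p + bound q).+1
  | If e p q => (eval_cost e + (bound p + bound q)).+1
  | While _ _ => 0
  end.

Lemma sem_frame p m a : a \notin writes p -> sem p m a = m a.
Proof.
elim: p m => //= [b ei ev|p IHp q IHq|e p IHp q IHq] m.
- by rewrite inE; apply: update_neq.
- by rewrite mem_cat negb_or => /andP[h1 h2]; rewrite IHq ?IHp.
- rewrite mem_cat negb_or => /andP[h1 h2].
  by case: ifP => _; [apply: IHq|apply: IHp].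
Qed.

Lemma wp_flat p m K (Q : memory -> Prop) :
  flat p -> bound p <= K -> Q (sem p m) -> wp p m K Q.
Proof.
move=> fl le q; suff [c ex lec] : exists2 c, exec p m c (sem p m) & c <= bound p.
  by exists c, (sem p m); split=> //; apply: leq_trans le.
elim: p m fl {K Q le q} => [|a ei ev|p IHp q IHq|e p IHp q IHq|//] m /=.
- by exists 1 => //; constructor.
- by move=> _; eexists; first exact: exec_write.
- move=> /andP[/IHp-/(_ m)[c1 e1 l1] /IHq-/(_ (sem p m))[c2 e2 l2]].
  by exists (c1 + c2).+1; [exact: exec_seq e1 e2|lia].
- move=> /andP[fp fq]; case: eqP => [e0|/eqP en0].
    have [c ex le] := IHq m fq.
    by exists (eval_cost e + c).+1; [exact: exec_if_false|lia].
  have [c ex le] := IHp m fp.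
  by exists (eval_cost e + c).+1; [exact: exec_if_true|lia].
Qed.

Lemma notin_sub (s s' : seq nat) b : all [in s] s' -> b \notin s -> b \notin s'.
Proof. by move=> /allP h; apply: contra => /h. Qed.

(** * Binary digits *)

Definition bit (x i : nat) : bool := odd (x %/ 2 ^ i).

Lemma bit_modS x n : x %% 2 ^ n.+1 = bit x n * 2 ^ n + x %% 2 ^ n.
Proof.
rewrite {1}(divn_eq x (2 ^ n)) /bit; set q := x %/ _; set r := x %% 2 ^ n.
have r_lt : r < 2 ^ n by rewrite ltn_mod expn_gt0.
rewrite -{1}[q]odd_double_half -muln2 mulnDl -mulnA -expnS -addnA addnCA.
rewrite modnMDl modn_small // expnS mul2n -addnn.
by case: odd; rewrite ?mul1n ?mul0n; lia.
Qed.

Lemma bit_le x n : bit x n = (2 ^ n <= x %% 2 ^ n.+1).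
Proof.
rewrite bit_modS; have := ltn_pmod x (expn_gt0 2 n : 0 < 2 ^ n).
by case: bit; rewrite ?mul1n ?mul0n; lia.
Qed.

Lemma bit_mod x n : x < 2 ^ n -> x = \sum_(i < n) bit x i * 2 ^ i.
Proof.
move=> lt; rewrite -{1}(modn_small lt); elim: n {lt} => [|n IH].
  by rewrite expn0 modn1 big_ord0.
by rewrite bit_modS big_ord_recr /= IH addnC.
Qed.

Lemma sum_bits_lt n (a : nat -> bool) : \sum_(i < n) a i * 2 ^ i < 2 ^ n.
Proof.
elim: n => [|n IH]; first by rewrite big_ord0.
rewrite big_ord_recr /= expnS; move: IH; set s := \sum_(_ < _) _.
by case: (a n); rewrite ?mul1n ?mul0n; lia.
Qed.

Lemma bit_sum n (a : nat -> bool) j :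
  bit (\sum_(i < n) a i * 2 ^ i) j = (j < n) && a j.
Proof.
elim: n => [|n IH]; first by rewrite big_ord0 /bit div0n.
rewrite big_ord_recr /=; set s := \sum_(_ < _) _ in IH *.
have lts : s < 2 ^ n := sum_bits_lt n a.
case: (ltngtP j n) => [lt|gt|->].
- have -> : s + a n * 2 ^ n = a n * 2 ^ (n - j) * 2 ^ j + s.
    by rewrite -mulnA -expnD subnK 1?ltnW // addnC.
  rewrite /bit divnMDl ?expn_gt0 // oddD oddM oddX.
  have -> : n - j == 0 = false by lia.
  by rewrite andbF -[odd _]/(bit s j) IH lt ltnS ltnW.
- rewrite /bit divn_small; first by rewrite ltnNge gt.
  apply: leq_trans (_ : 2 ^ n.+1 <= _); last by rewrite leq_exp2l.
  by rewrite expnS; case: (a n); rewrite ?mul1n ?mul0n; lia.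
- by rewrite /bit addnC divnMDl ?expn_gt0 // divn_small // addn0 oddb ltnSn.
Qed.

Lemma bit_small x n j : x < 2 ^ n -> n <= j -> bit x j = false.
Proof. by move=> lt le; rewrite (bit_mod lt) bit_sum ltnNge le. Qed.

Lemma bit0 j : bit 0 j = false.
Proof. by rewrite /bit div0n. Qed.

Lemma eq_from_bit n x y :
  x < 2 ^ n -> y < 2 ^ n -> (forall i, i < n -> bit x i = bit y i) -> x = y.
Proof.
move=> ltx lty eqb; rewrite (bit_mod ltx) (bit_mod lty).
by apply: eq_bigr => i _; rewrite eqb.
Qed.

Lemma bit_exp x j : bit x j -> 2 ^ j <= x.
Proof. by rewrite bit_le => /leq_trans; apply; apply: leq_mod. Qed.

(** There is no borrow: in the binary expansion of [x] exactly one summand disappears. *)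
Lemma bit_sub_exp x j i : bit x j -> bit (x - 2 ^ j) i = bit x i && (i != j).
Proof.
move=> bj; pose n := (maxn x j).+1.
have ltx : x < 2 ^ n.
  by apply: leq_ltn_trans (leq_maxl x j) _; apply: ltnW; apply: ltn_expl.
have ltj : j < n by rewrite ltnS leq_maxr.
have -> : x - 2 ^ j = \sum_(i < n) (bit x i && (i != j :> nat)) * 2 ^ i.
  rewrite {1}(bit_mod ltx) (bigD1 (Ordinal ltj)) //= bj mul1n addKn.
  rewrite [RHS](bigD1 (Ordinal ltj)) //= eqxx andbF mul0n add0n.
  apply: eq_bigr => k; rewrite -val_eqE /= => ->; by rewrite andbT.
rewrite (bit_sum n (fun i => bit x i && (i != j))).
case: (ltnP i n) => //= le.
by rewrite (bit_small ltx le).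
Qed.

Lemma bit_add_exp x j i :
  bit x j = false -> bit (x + 2 ^ j) i = bit x i || (i == j).
Proof.
move=> bj.
have bj' : bit (x + 2 ^ j) j.
  (* The sum has digit 1 at [j], so the subtraction lemma, applied to the sum, recovers [x]. *)
  rewrite /bit -{1}[2 ^ j]mul1n addnC divnMDl ?expn_gt0 // oddD.
  by rewrite -[odd (x %/ _)]/(bit x j) bj.
have := bit_sub_exp i bj'; rewrite addnK.
by case: (eqVneq i j) => [->|_]; rewrite ?orbT // orbF andbT.
Qed.

Lemma exists_mask n (a : nat -> bool) :
  exists2 k, k < 2 ^ n & forall j, j < n -> bit k j = a j.
Proof.
exists (\sum_(i < n) a i * 2 ^ i); first exact: sum_bits_lt.
by move=> j lt; rewrite bit_sum lt.
Qed.

(** * Trails of an edge-indexed instance *)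

Record instance := Instance {
  nE : nat;
  src : nat -> nat;
  dst : nat -> nat;
  tms : nat -> seq nat
}.

Section Instance.
Variable D : instance.

Definition mxt (e : nat) : nat := \max_(t <- tms D e) t.
Definition mnt (e : nat) : nat := \big[minn/mxt e]_(t <- tms D e) t.
Definition alive (e t : nat) : bool := mnt e <= t <= mxt e.

Definition wf : Prop :=
  forall e, e < nE D ->
    [/\ tms D e != [::], uniq (tms D e) & all (ltn 0) (tms D e)].

Definition lamD : nat := \max_(e < nE D) mxt e.

(** Decreasing order, because the parser pushes each new edge at the front of the lists of its
    interval. *)
Fixpoint alist (j t : nat) : seq nat :=
  if j is j'.+1 then if alive j' t then j' :: alist j' t else alist j' t
  else [::].

Definition joins (e c c' : nat) : Prop :=
  (src D e = c /\ dst D e = c') \/ (dst D e = c /\ src D e = c').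

(* [Tr a t x c]: some strict temporal trail from [a] to [c] has all its times
   at most [t] and uses exactly the edges at which [x] has a binary digit 1. *)
Fixpoint Tr (a t x c : nat) : Prop :=
  if t is t'.+1 then
    Tr a t' x c \/
    exists e c', [/\ e < nE D, t \in tms D e, bit x e, joins e c' c
                   & Tr a t' (x - 2 ^ e) c']
  else x = 0 /\ c = a.

Definition Full (t x : nat) : Prop :=
  forall e, e < nE D -> mxt e <= t -> bit x e.

Definition Reach (a t x c : nat) : Prop := Tr a t x c /\ Full t x.

Lemma TrS a t x c : Tr a t.+1 x c <-> (Tr a t x c \/
  exists e c', [/\ e < nE D, t.+1 \in tms D e, bit x e, joins e c' c
                 & Tr a t (x - 2 ^ e) c']).
Proof. by []. Qed.

Lemma mxt_ge e t : t \in tms D e -> t <= mxt e.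
Proof. by move=> h; rewrite /mxt (big_rem t h) leq_maxl. Qed.

Lemma big_minn_le (s : seq nat) d t : t \in s -> \big[minn/d]_(i <- s) i <= t.
Proof.
elim: s => // i s IH; rewrite inE big_cons geq_min => /orP[/eqP->|/IH->].
  by rewrite leqnn.
by rewrite orbT.
Qed.

Lemma big_minn_mem (s : seq nat) d : \big[minn/d]_(i <- s) i \in d :: s.
Proof.
elim: s => [|i s IH]; first by rewrite big_nil inE.
rewrite big_cons !inE; move: IH; rewrite inE /minn.
by case: ifP => _ /orP[]; rewrite ?eqxx ?orbT // => ->; rewrite ?orbT.
Qed.

Lemma big_maxn_mem (s : seq nat) : s != [::] -> \max_(i <- s) i \in s.
Proof.
elim: s => // i s IH _; rewrite big_cons inE.
have [->|/IH h] := eqVneq s [::]; first by rewrite big_nil maxn0 eqxx.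
by rewrite /maxn; case: ifP => _; rewrite ?h ?eqxx ?orbT.
Qed.

Lemma mnt_le e t : t \in tms D e -> mnt e <= t.
Proof. exact: big_minn_le. Qed.

Hypothesis wfD : wf.

Lemma mxt_mem e : e < nE D -> mxt e \in tms D e.
Proof. by move=> /wfD[ne _ _]; apply: big_maxn_mem. Qed.

Lemma mnt_mem e : e < nE D -> mnt e \in tms D e.
Proof.
move=> /[dup] he /mxt_mem hm; have := big_minn_mem (tms D e) (mxt e).
by rewrite -/(mnt e) inE => /orP[/eqP->|].
Qed.

Lemma mnt_le_mxt e : e < nE D -> mnt e <= mxt e.
Proof. by move=> /mxt_mem; apply: mnt_le. Qed.

Lemma tms_gt0 e t : e < nE D -> t \in tms D e -> 0 < t.
Proof. by move=> /wfD[_ _ /allP h] /h. Qed.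

Lemma mnt_gt0 e : e < nE D -> 0 < mnt e.
Proof. by move=> /[dup] he /mnt_mem; apply: tms_gt0. Qed.

Lemma tms_alive e t : t \in tms D e -> alive e t.
Proof. by move=> h; rewrite /alive mnt_le ?mxt_ge. Qed.

Lemma size_tms e : e < nE D -> size (tms D e) <= mxt e - mnt e + 1.
Proof.
move=> he; have [_ u _] := wfD he.
have -> : mxt e - mnt e + 1 = size (iota (mnt e) (mxt e - mnt e + 1)).
  by rewrite size_iota.
apply: uniq_leq_size => // t ht.
by rewrite mem_iota mnt_le //=; have := mxt_ge ht; have := mnt_le_mxt he; lia.
Qed.

Lemma mem_alist j t e : (e \in alist j t) = (e < j) && alive e t.
Proof.
elim: j => //= j IH; case al: (alive j t).
  by rewrite inE IH ltnS [in RHS]leq_eqVlt; case: eqP => [->|//]; rewrite al.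
by rewrite IH ltnS [in RHS]leq_eqVlt; case: eqP => //= ->; rewrite ltnn al.
Qed.

Lemma uniq_alist j t : uniq (alist j t).
Proof.
by elim: j => //= j IH; case: ifP => //= _; rewrite mem_alist ltnn.
Qed.

Lemma sum_alist j t (F : nat -> nat) :
  \sum_(e <- alist j t) F e = \sum_(e < j) alive e t * F e.
Proof.
elim: j => [|j IH] /=; first by rewrite big_nil big_ord0.
rewrite big_ord_recr /= -IH; case: (alive j t).
  by rewrite big_cons mul1n addnC.
by rewrite mul0n addn0.
Qed.

Lemma Tr_mono a t t' x c : t <= t' -> Tr a t x c -> Tr a t' x c.
Proof.
elim: t' => [|t' IH]; first by rewrite leqn0 => /eqP->.
by rewrite leq_eqVlt => /orP[/eqP->|/IH h /h] //; left.
Qed.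

Lemma Tr_bit a t x c : Tr a t x c ->
  x < 2 ^ nE D /\ forall e, bit x e -> mnt e <= t.
Proof.
elim: t x c => [|t IH] x c /=.
  by move=> [-> _]; rewrite expn_gt0; split=> // e; rewrite bit0.
move=> [/IH[lt h]|[e [c' [he ht be _ /IH[lt h]]]]].
  by split=> // e /h; lia.
split.
  have -> : x = \sum_(i < nE D) (bit x i && true) * 2 ^ i.
    rewrite -{1}(subnK (bit_exp be)) {1}(bit_mod lt).
    rewrite [RHS](bigD1 (Ordinal he)) //= be mul1n addnC; congr (_ + _).
    rewrite (bigD1 (Ordinal he)) //= bit_sub_exp // eqxx andbF mul0n add0n.
    by apply: eq_bigr => i; rewrite bit_sub_exp // -val_eqE /= => ->.
  exact: (sum_bits_lt _ (fun i => bit x i && true)).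
move=> i bi; have [->|ne] := eqVneq i e; first exact: mnt_le.
by apply/leqW/h; rewrite bit_sub_exp // bi.
Qed.

(** Handshake argument: appending an edge between [c'] and [c] flips the degree parity at [c'] and
    at [c], and the flip at [c'] cancels the old end. *)
Lemma Tr_odd a t x c v : Tr a t x c ->
  odd (\sum_(e < nE D) bit x e * ((src D e == v) + (dst D e == v)))
  = (a == v) (+) (c == v).
Proof.
elim: t x c => [|t IH] x c /=.
  move=> [-> ->]; rewrite addbb big1 // => e _; by rewrite bit0.
move=> [/IH //|[e [c' [he ht be jn /IH]]]].
rewrite (bigD1 (Ordinal he)) //= bit_sub_exp // eqxx andbF mul0n add0n => h.
rewrite (bigD1 (Ordinal he)) //= be mul1n.
rewrite oddD (_ : odd (\sum_(_ < _ | _) _) = (a == v) (+) (c' == v)); last first.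
  rewrite -h; congr (odd _); apply: eq_bigr => i; rewrite -val_eqE /= => ne.
  by rewrite bit_sub_exp // ne andbT.
rewrite oddD !oddb.
by case: jn => [[-> ->]|[-> ->]]; case: (a == v); case: (c' == v); case: (c == v).
Qed.

(** Degree parity at [c'] decides. This is what allows a single table cell per edge set. *)
Lemma Tr_end a t t' x c c' : Tr a t x c -> Tr a t' x c' -> c = c'.
Proof.
move=> /(Tr_odd c') h /(Tr_odd c'); rewrite h eqxx => /addbI/eqP //.
Qed.

Lemma FullS t x : Full t.+1 x -> Full t x.
Proof. by move=> h e he le; apply: h => //; lia. Qed.

Definition expired (t : nat) : nat := \sum_(e < nE D) (mxt e <= t) * 2 ^ e.

(* The edge set of mask [k] at time [t.+1]: all edges expired by [t], and those
   alive edges whose positions in the list are binary digits 1 of [k]. *)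
Definition keyof (t k : nat) : nat :=
  expired t +
  \sum_(j < size (alist (nE D) t.+1)) bit k j * 2 ^ nth 0 (alist (nE D) t.+1) j.

(** As one sum over all edges the digits can be read off. No edge is both expired at [t] and alive
    at [t.+1], so each power of two occurs at most once. *)
Lemma keyofE t k : keyof t k = \sum_(e < nE D)
  ((mxt e <= t) || alive e t.+1 && bit k (index (val e) (alist (nE D) t.+1)))
  * 2 ^ e.
Proof.
rewrite /keyof; set f := alist _ _.
have -> : \sum_(j < size f) bit k j * 2 ^ nth 0 f j
        = \sum_(e <- f) bit k (index e f) * 2 ^ e.
  rewrite (big_nth 0) big_mkord; apply: eq_bigr => j _.
  by rewrite index_uniq // uniq_alist.
rewrite sum_alist -big_split; apply: eq_bigr => e _ /=.
rewrite /alive; case: (leqP (mxt e) t) => [le|gt] /=.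
  by rewrite andbF mul0n addn0.
by rewrite mul0n add0n mulnA mulnb.
Qed.

Lemma bit_keyof t k e : e < nE D -> bit (keyof t k) e =
  (mxt e <= t) || alive e t.+1 && bit k (index e (alist (nE D) t.+1)).
Proof.
move=> he; rewrite keyofE (bit_sum _ (fun e =>
  (mxt e <= t) || alive e t.+1 && bit k (index e (alist (nE D) t.+1)))).
by rewrite he.
Qed.

Lemma keyof_lt t k : keyof t k < 2 ^ nE D.
Proof.
rewrite keyofE; exact: (sum_bits_lt _ (fun e =>
  (mxt e <= t) || alive e t.+1 && bit k (index e (alist (nE D) t.+1)))).
Qed.

Lemma bit_keyof_nth t k j : j < size (alist (nE D) t.+1) ->
  bit (keyof t k) (nth 0 (alist (nE D) t.+1) j) = bit k j.
Proof.
move=> lt; have := mem_nth 0 lt; rewrite mem_alist => /andP[he al].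
rewrite bit_keyof // index_uniq ?uniq_alist // al /=.
by move: al => /andP[_ al]; rewrite leqNgt al.
Qed.

Lemma keyof_inj t k k' :
  k < 2 ^ size (alist (nE D) t.+1) -> k' < 2 ^ size (alist (nE D) t.+1) ->
  keyof t k = keyof t k' -> k = k'.
Proof.
move=> lt lt' eqk; apply: (eq_from_bit lt lt') => j hj.
by rewrite -!(bit_keyof_nth _ hj) eqk.
Qed.

(** Removing the last edge of a trail is clearing a digit of the mask, so the predecessors of a mask
    are smaller masks. *)
Lemma keyof_sub t k j : j < size (alist (nE D) t.+1) -> bit k j ->
  keyof t (k - 2 ^ j) = keyof t k - 2 ^ nth 0 (alist (nE D) t.+1) j.
Proof.
move=> hj bj; have hb := bit_keyof_nth k hj; rewrite bj in hb.
have := mem_nth 0 hj; set e0 := nth _ _ _ => h0.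
apply: (@eq_from_bit (nE D)); first exact: keyof_lt.
  by apply: leq_ltn_trans (keyof_lt t k); apply: leq_subr.
move=> e he; rewrite bit_sub_exp // !bit_keyof // bit_sub_exp //.
move: h0; rewrite mem_alist => /andP[he0 al0].
have [->|ne] := eqVneq e e0.
  rewrite index_uniq ?uniq_alist // eqxx !andbF orbF.
  by move: al0 => /andP[_ al0]; rewrite leqNgt al0.
rewrite andbT; case al: (alive e t.+1) => //=; congr (_ || _).
rewrite (_ : _ != j) ?andbT //; apply: contra_neq ne => ej.
by rewrite /e0 -ej nth_index // mem_alist he al.
Qed.

(** By [Tr_bit] every used edge has appeared by [t.+1]; if it has not expired by [t], it is alive.
    So only the digits on the alive list are free. *)
Lemma keyof_surj a t x c : Tr a t.+1 x c -> Full t x ->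
  exists2 k, k < 2 ^ size (alist (nE D) t.+1) & x = keyof t k.
Proof.
move=> /Tr_bit[lt h] fx; set f := alist _ _.
have [k ltk hk] := exists_mask (size f) (fun j => bit x (nth 0 f j)).
exists k => //; apply: (eq_from_bit lt (keyof_lt _ _)) => e he.
rewrite bit_keyof //; case: leqP => [le|gt] /=; first by rewrite fx.
case al: (alive e t.+1) => /=.
  have ef : e \in f by rewrite mem_alist he.
  by rewrite hk ?index_mem // nth_index.
by apply: contraFF al => /h; rewrite /alive gt => ->.
Qed.

Lemma Full_keyof t k : Full t (keyof t k).
Proof. by move=> e he le; rewrite bit_keyof // le. Qed.

Lemma expired_lam : expired lamD = \sum_(e < nE D) 2 ^ e.
Proof.
apply: eq_bigr => e _; rewrite (_ : mxt e <= _) ?mul1n //.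
exact: (leq_bigmax e).
Qed.

Lemma expired0 : expired 0 = 0.
Proof.
apply: big1 => e _; have := mnt_gt0 (ltn_ord e); have := mnt_le_mxt (ltn_ord e).
by case: (mxt e) => //; lia.
Qed.

Lemma Full0 x : Full 0 x.
Proof. by move=> e he; have := mnt_gt0 he; have := mnt_le_mxt he; lia. Qed.

(** An edge whose last time is [t.+1] is alive then, so scanning the alive list finds all newly
    expired edges. *)
Lemma expiredS t : expired t.+1 =
  expired t + \sum_(e <- alist (nE D) t.+1) (mxt e <= t.+1) * 2 ^ e.
Proof.
rewrite sum_alist -big_split; apply: eq_bigr => e _ /=.
have := mnt_le_mxt (ltn_ord e); rewrite /alive => hm.
have [gt|] := ltnP t.+1 (mxt e).
  by rewrite muln0 addn0 (_ : mxt e <= t = false) //; lia.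
rewrite leq_eqVlt => /orP[/eqP eqm|lt].
  rewrite eqm leqnn ltnn (_ : mnt e <= t.+1) ?mul1n //; lia.
rewrite -ltnS lt (_ : t < mxt e = false) ?andbF ?mul0n ?addn0 //; lia.
Qed.

End Instance.
Arguments Tr : simpl never.

(** * The program *)

(* Arrays [r...] are registers: only their cell 0 is used.  The edges alive at
   time t form a linked list: [aHEAD] at t is its first edge, [aNEXT] at the
   address of (e, t) the edge after e, an edge e being stored as e + 1 and the
   end of the list as 0.  The address of (e, t) is [aOFF] at e plus t, also used
   by [aACT].  The table entry of an edge set is valid if its [aVIS] equals the
   stamp [rSIG]; its [aCUR] is then the end of the trail. *)
Definition aIN := 0.
Definition rOUT := 1.
Definition rPOS := 2.
Definition rJ := 3.
Definition rOFF := 4.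
Definition rWT := 5.
Definition rMX := 6.
Definition rMN := 7.
Definition rI := 8.
Definition rT := 9.
Definition rLAM := 10.
Definition rT1 := 11.
Definition rCNT := 12.
Definition aU := 13.
Definition aV := 14.
Definition aMX := 15.
Definition aW := 16.
Definition aOFF := 17.
Definition aACT := 18.
Definition aHEAD := 19.
Definition aNEXT := 20.
Definition rSIG := 21.
Definition rX := 22.
Definition rN := 23.
Definition rK := 24.
Definition rY := 25.
Definition rZ := 26.
Definition rOK := 27.
Definition rFND := 28.
Definition rC := 29.
Definition rA := 30.
Definition rP := 31.
Definition rQ := 32.
Definition rJJ := 33.
Definition rPW := 34.
Definition rD := 35.
Definition aFL := 36.
Definition aBIT := 37.
Definition aPOW := 38.
Definition aVIS := 39.
Definition aCUR := 40.

Declare Scope prog_scope.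
Delimit Scope prog_scope with prog.
Notation "$ a" := (Read a (Const 0)) (at level 2, format "$ a") : prog_scope.
Notation "a `[ e ]" := (Read a e%prog)
  (at level 2, e at level 99, format "a `[ e ]") : prog_scope.
Notation "x + y" := (Add x%prog y%prog) : prog_scope.
Notation "x - y" := (Defs.Sub x%prog y%prog) : prog_scope.
Notation "x <>? y" := (Add (Defs.Sub x%prog y%prog) (Defs.Sub y%prog x%prog))
  (at level 70) : prog_scope.
Notation "p ;; q" := (Seq p%prog q%prog)
  (at level 90, right associativity) : prog_scope.
Notation "a ::= e" := (Write a (Const 0) e%prog) (at level 80) : prog_scope.
Arguments Write a (ei ev)%_prog.
Arguments If e%_prog (p q)%_prog.
Arguments While e%_prog p%_prog.
Local Open Scope prog_scope.

(** The summand [Const 1 - $rI] is nonzero only at the first time of an edge, which thus enters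
    [rMN] without an infinite initial value. In [edge_done] the same device initialises [rT1], the
    least last time. *)
Definition time_step : prog :=
  rT ::= aIN`[$rPOS] ;;
  Write aACT ($rOFF + $rT) (Const 1) ;;
  If ($rT - $rMX) (rMX ::= $rT) Skip ;;
  If (($rMN - $rT) + (Const 1 - $rI)) (rMN ::= $rT) Skip ;;
  rPOS ::= $rPOS + Const 1 ;;
  rI ::= $rI + Const 1.

Definition link_step : prog :=
  Write aNEXT ($rOFF + $rT) (aHEAD`[$rT]) ;;
  Write aHEAD ($rT) ($rJ + Const 1) ;;
  rT ::= $rT + Const 1.

Definition edge_init : prog :=
  Write aU ($rJ) (aIN`[$rPOS]) ;;
  Write aV ($rJ) (aIN`[$rPOS + Const 1]) ;;
  rCNT ::= aIN`[$rPOS + Const 2] ;;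
  rPOS ::= $rPOS + Const 3 ;;
  rMX ::= Const 0 ;; rMN ::= Const 0 ;; rI ::= Const 0.

Definition edge_mid : prog :=
  Write aMX ($rJ) ($rMX) ;;
  Write aOFF ($rJ) ($rOFF) ;;
  Write aW ($rJ) ($rWT) ;;
  rT ::= $rMN.

Definition edge_done : prog :=
  If ($rMX - $rLAM) (rLAM ::= $rMX) Skip ;;
  If (($rT1 - $rMX) + (Const 1 - $rJ)) (rT1 ::= $rMX) Skip ;;
  rOFF ::= $rOFF + ($rMX + Const 1) ;;
  rWT ::= $rWT + $rWT ;;
  rJ ::= $rJ + Const 1.

Definition edge_step : prog :=
  edge_init ;;
  While ($rCNT - $rI) time_step ;;
  edge_mid ;;
  While (($rMX + Const 1) - $rT) link_step ;;
  edge_done.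

Definition parse : prog :=
  (rPOS ::= Const 2 ;; rWT ::= Const 1) ;;
  While (aIN`[Const 1] - $rJ) edge_step.

(** Copying the linked list into an array gives each alive edge a position, which serves as its
    digit in the masks. *)
Definition load_step : prog :=
  Write aFL ($rN) ($rP - Const 1) ;;
  Write aPOW ($rN) ($rPW) ;;
  rPW ::= $rPW + $rPW ;;
  rP ::= aNEXT`[aOFF`[$rP - Const 1] + $rT] ;;
  rN ::= $rN + Const 1.

Definition load : prog :=
  (rN ::= Const 0 ;; rPW ::= Const 1 ;; rP ::= aHEAD`[$rT]) ;;
  While ($rP) load_step.

(** Digits are split off from the top by comparison with powers of two. An edge with digit 0 and
    last time at most [rT] clears [rOK], since the set then violates [Full] at the new time. *)
Definition decode_step : prog :=
  rJJ ::= $rJJ - Const 1 ;;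
  If (($rZ + Const 1) - aPOW`[$rJJ])
    (Write aBIT ($rJJ) (Const 1) ;;
     rZ ::= $rZ - aPOW`[$rJJ] ;;
     rY ::= $rY + aW`[aFL`[$rJJ]])
    (Write aBIT ($rJJ) (Const 0) ;;
     If (($rT + Const 1) - aMX`[aFL`[$rJJ]]) (rOK ::= Const 0) Skip).

Definition decode : prog :=
  (rZ ::= $rK ;; rY ::= $rX ;; rOK ::= Const 1 ;; rJJ ::= $rN) ;;
  While ($rJJ) decode_step.

Definition pull_edge : prog :=
  rD ::= $rY - aW`[aFL`[$rJJ]] ;;
  If (aVIS`[$rD] <>? $rSIG) Skip
    (If (aCUR`[$rD] <>? aU`[aFL`[$rJJ]])
       (If (aCUR`[$rD] <>? aV`[aFL`[$rJJ]]) Skip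
          (rFND ::= Const 1 ;; rC ::= aU`[aFL`[$rJJ]]))
       (rFND ::= Const 1 ;; rC ::= aV`[aFL`[$rJJ]])).

Definition pull_step : prog :=
  If (aBIT`[$rJJ])
    (If (aACT`[aOFF`[aFL`[$rJJ]] + $rT]) pull_edge Skip) Skip ;;
  rJJ ::= $rJJ + Const 1.

Definition pull : prog :=
  (rFND ::= Const 0 ;;
   If (aVIS`[$rY] <>? $rSIG) Skip (rFND ::= Const 1 ;; rC ::= aCUR`[$rY]) ;;
   rJJ ::= Const 0) ;;
  While ($rN - $rJJ) pull_step.

Definition commit : prog :=
  If ($rOK)
    (If ($rFND)
       (Write aVIS ($rY) ($rSIG + Const 1) ;; Write aCUR ($rY) ($rC)) Skip)
    Skip.

Definition mask_step : prog :=
  rK ::= $rK - Const 1 ;; decode ;; pull ;; commit.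

Definition expire_step : prog :=
  If (($rT + Const 1) - aMX`[aFL`[$rJJ]]) (rX ::= $rX + aW`[aFL`[$rJJ]]) Skip ;;
  rJJ ::= $rJJ + Const 1.

Definition stage : prog :=
  rT ::= $rT + Const 1 ;;
  load ;;
  rK ::= $rPW ;;
  While ($rK) mask_step ;;
  rJJ ::= Const 0 ;;
  While ($rN - $rJJ) expire_step ;;
  rSIG ::= $rSIG + Const 1.

(** Address 0 is the empty set, whose trail ends at the start vertex; the fresh stamp discards what
    the previous start left. *)
Definition run_init : prog :=
  rSIG ::= $rSIG + Const 1 ;;
  Write aVIS (Const 0) ($rSIG) ;;
  Write aCUR (Const 0) ($rA) ;;
  rX ::= Const 0 ;; rT ::= Const 0.

Definition run_done : prog :=
  If (aVIS`[$rX] <>? $rSIG) Skip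
    (If (aCUR`[$rX] <>? $rA) Skip (rOUT ::= Const 1)).

Definition run : prog :=
  run_init ;; While ($rLAM - $rT) stage ;; run_done.

Definition start_step : prog :=
  rA ::= aU`[$rQ - Const 1] ;; run ;;
  rA ::= aV`[$rQ - Const 1] ;; run ;;
  rQ ::= aNEXT`[aOFF`[$rQ - Const 1] + $rT1].

(** Edgeless graphs are answered by the first line: the empty sequence is a circuit as soon as some
    vertex can serve as its start. The list at [rT1] is then empty and the final loop does
    nothing. *)
Definition euler_prog : prog :=
  If (aIN`[Const 1]) Skip (If (aIN`[Const 0]) (rOUT ::= Const 1) Skip) ;;
  parse ;;
  rQ ::= aHEAD`[$rT1] ;;
  While ($rQ) start_step.

Local Close Scope prog_scope.

Ltac upd1 := match goal with
  | |- context [update ?m ?a ?i ?v ?b] => rewrite (@update_neq m a i v b isT)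
  | _ => rewrite update_eq
  end.
Ltac upd := repeat upd1.

(** * Memory layout of the parsed data, and loading of the alive edges *)

Section Correct.
Variable D : instance.
Hypothesis wfD : wf D.

(** The block of an edge has room for the times from 0 to its last one, so blocks are disjoint.
    Times before the interval cost addresses but no steps. *)
Definition off (e : nat) : nat := \sum_(i < e) (mxt D i).+1.

Definition ptr (s : seq nat) : nat := if s is e :: _ then e.+1 else 0.

Record env (m : memory) : Prop := Env {
  env_U : forall e, e < nE D -> m aU e = src D e;
  env_V : forall e, e < nE D -> m aV e = dst D e;
  env_MX : forall e, e < nE D -> m aMX e = mxt D e;
  env_W : forall e, e < nE D -> m aW e = 2 ^ e;
  env_OFF : forall e, e < nE D -> m aOFF e = off e;
  env_ACT : forall e t, e < nE D -> alive D e t ->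
    m aACT (off e + t)%N = (t \in tms D e);
  env_HEAD : forall t, m aHEAD t = ptr (alist D (nE D) t);
  env_NEXT : forall e t, e < nE D -> alive D e t ->
    m aNEXT (off e + t)%N = ptr (alist D e t);
  env_LAM : m rLAM 0 = lamD D
}.

Lemma env_frame m m' : env m ->
  m' aU = m aU -> m' aV = m aV -> m' aMX = m aMX -> m' aW = m aW ->
  m' aOFF = m aOFF -> m' aACT = m aACT -> m' aHEAD = m aHEAD ->
  m' aNEXT = m aNEXT -> m' rLAM = m rLAM -> env m'.
Proof.
by move=> [h1 h2 h3 h4 h5 h6 h7 h8 h9] e1 e2 e3 e4 e5 e6 e7 e8 e9;
  split; rewrite ?e1 ?e2 ?e3 ?e4 ?e5 ?e6 ?e7 ?e8 ?e9.
Qed.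

(** What follows [e] in the decreasing list consists of the alive edges below [e]. Hence a pointer
    stored while parsing [e] stays right when later edges are pushed in front. *)
Lemma drop_alist j t i : i < size (alist D j t) ->
  alist D (nth 0 (alist D j t) i) t = drop i.+1 (alist D j t).
Proof.
elim: j i => //= j IH i; case: ifP => [_|_] /=; last exact: IH.
by case: i => [|i] /=; [rewrite drop0|exact: IH].
Qed.

Lemma ptr_drop s i : i < size s -> ptr (drop i s) = (nth 0 s i).+1.
Proof. by move=> lt; rewrite (drop_nth 0 lt). Qed.

Section Stage.
Variables (m0 : memory) (t : nat).
Let f := alist D (nE D) t.
Hypotheses (env0 : env m0) (T0 : m0 rT 0 = t).

Definition loaded (m : memory) : Prop :=
  [/\ m rN 0 = size f, m rPW 0 = 2 ^ size f,
      forall j, j < size f -> m aFL j = nth 0 f j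
    & forall j, j < size f -> m aPOW j = 2 ^ j].

Lemma nth_f j : j < size f -> nth 0 f j < nE D /\ alive D (nth 0 f j) t.
Proof. by move=> /(mem_nth 0); rewrite mem_alist => /andP. Qed.

Lemma wp_load : wp load m0 (100 + 100 * size f) loaded.
Proof.
apply: (@wp_seq _ _ _ 20 (100 * size f + 50)); last lia.
apply: wp_flat => //=; set m1 := (X in wp _ X).
have env1 : env m1 by apply: (env_frame env0).
have T1 : m1 rT 0 = t by [].
pose I i (m : memory) := [/\ m rN 0 = i, m rPW 0 = 2 ^ i,
   m rP 0 = ptr (drop i f),
   forall j, j < i -> m aFL j = nth 0 f j & forall j, j < i -> m aPOW j = 2 ^ j].
apply: (@wp_while_const _ _ (size f) I 60).
- by split=> //; rewrite /m1; upd; rewrite T0 (env_HEAD env0) drop0.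
- move=> i m lt fr [hN hPW hP hFL hPOW].
  have env2 : env m by apply: (env_frame env1); rewrite fr.
  have T2 : m rT 0 = t by rewrite fr.
  have [hi ali] := nth_f lt.
  rewrite (ptr_drop lt) in hP.
  split; first by rewrite /= hP.
  apply: wp_flat => //=; split; upd.
  + by rewrite hN addn1.
  + by rewrite hPW expnS mul2n addnn.
  + rewrite hP subn1 /= T2 (env_OFF env2) // (env_NEXT env2) //.
    by rewrite /f drop_alist.
  + move=> j; rewrite update_at hN ltnS leq_eqVlt hP subn1.
    by case: eqP => [->|_ /= /hFL].
  + move=> j; rewrite update_at hN ltnS leq_eqVlt hPW.
    by case: eqP => [->|_ /= /hPOW].
- move=> m fr [hN hPW hP hFL hPOW]; split; last by split.
  by rewrite /= hP drop_size.
- by rewrite /=; lia.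
Qed.

End Stage.
End Correct.

(** * Processing one mask: decoding, lookup of predecessors, update of the table *)

Section Mask.
Variable D : instance.
Hypothesis wfD : wf D.
Variables (a t : nat).
Let f := alist D (nE D) t.+1.

Definition decoded (k : nat) (m : memory) : Prop :=
  [/\ m rY 0 = keyof D t k, forall j, j < size f -> m aBIT j = bit k j
    & m rOK 0 != 0 <-> Full D t.+1 (keyof D t k)].

(** Only alive edges need a test: edges expired by [t] lie in every key, and those with last time
    [t.+1] are still on the list. *)
Lemma FullS_keyof k : Full D t.+1 (keyof D t k) <->
  all (fun j => bit k j || (t.+1 < mxt D (nth 0 f j))) (iota 0 (size f)).
Proof.
split=> [fl|/allP h e he le].
  apply/allP => j; rewrite mem_iota /= add0n => lt.
  have [he _] := nth_f lt; rewrite -(bit_keyof_nth _ lt).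
  by case: leqP => [/(fl _ he)->//|]; rewrite orbT.
rewrite bit_keyof //; case: leqP => //= gt.
have al : alive D e t.+1.
  rewrite /alive gt andbT (leq_trans (mnt_le_mxt wfD he)) //.
have ef : e \in f by rewrite mem_alist he.
rewrite al /=; have := h (index e f); rewrite mem_iota /= add0n index_mem.
by move=> /(_ ef); rewrite nth_index // ltnNge le orbF.
Qed.

Lemma wp_decode m0 k : env D m0 -> loaded D t.+1 m0 -> m0 rT 0 = t.+1 ->
  m0 rK 0 = k -> k < 2 ^ size f -> m0 rX 0 = expired D t ->
  wp decode m0 (100 + 100 * size f) (decoded k).
Proof.
move=> env0 [hN _ hFL hPOW] hT hK ltk hX.
apply: (@wp_seq _ _ _ 20 (100 * size f + 50)); last lia.
apply: wp_flat => //=; set m1 := (X in wp _ X).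
have env1 : env D m1 by apply: (env_frame env0).
pose n := size f.
(* After [i] rounds the top [i] digits are known and [rZ] holds the remaining low part. *)
pose I i (m : memory) := [/\ m rJJ 0 = n - i, m rZ 0 = k %% 2 ^ (n - i),
   m rY 0 = expired D t + \sum_(n - i <= j < n) bit k j * 2 ^ nth 0 f j,
   forall j, n - i <= j < n -> m aBIT j = bit k j
   & m rOK 0 = all (fun j => bit k j || (t.+1 < mxt D (nth 0 f j)))
                   (iota (n - i) i)].
apply: (@wp_while_const _ _ n I 80).
- rewrite /I /m1 subn0; split=> //; upd.
  + by rewrite modn_small.
  + by rewrite big_geq // addn0.
  + by move=> j; lia.
- move=> i m lt fr [hJ hZ hY hB hO].
  have env2 : env D m by apply: (env_frame env1); rewrite fr.
  set d := n - i.+1.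
  have ed : n - i = d.+1 by rewrite /d; lia.
  have ltd : d < n by rewrite /d; lia.
  have jj : (n - i - 1)%N = d by rewrite ed subn1.
  rewrite ed in hZ hY hB hO.
  have [he al] := nth_f ltd.
  have hF : m aFL d = nth 0 f d by rewrite fr //; exact: hFL.
  have hT2 : m rT 0 = t.+1 by rewrite fr.
  have hP : m aPOW d = 2 ^ d by rewrite fr //; exact: hPOW.
  split; first by rewrite /= hJ ed.
  apply: wp_flat => //; rewrite /I -/d /=; upd; rewrite hJ jj hP hZ addn1.
  have -> : ((k %% 2 ^ d.+1).+1 - 2 ^ d == 0) = ~~ bit k d by rewrite bit_le; lia.
  rewrite (big_ltn ltd).
  case bd: (bit k d) => /=; upd.
    split=> //.
    + by rewrite bit_modS bd mul1n addKn.
    + by rewrite hY hF (env_W env2) // mul1n; lia.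
    + move=> j; rewrite update_at; case: eqP => [->|ne]; first by rewrite bd.
      by move=> hj; apply: hB; lia.
  upd; rewrite hF (env_MX env2) // hT2.
  have -> : (t.+1 + 1 - mxt D (nth 0 f d) == 0) = (t.+1 < mxt D (nth 0 f d)) by lia.
  by case: ifP => _ /=; upd; split=> //; rewrite ?hZ ?bit_modS ?bd ?mul0n //;
    move=> j; rewrite update_at; case: eqP => [->|ne]; rewrite ?bd // => hj;
    apply: hB; lia.
- move=> m fr [hJ hZ hY hB hO]; rewrite subnn in hJ hZ hY hB hO.
  split=> //; split=> //; first by rewrite hY /keyof big_mkord.
  by rewrite hO FullS_keyof; case: all.
- by rewrite /=; lia.
Qed.

(* The masks are treated in decreasing order, and the entry of a mask is computed
   from entries of masks that are not larger: those below [k] still carry the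
   old stamp [sg], those from [k] on the new one. *)
Definition table (sg k : nat) (m : memory) : Prop :=
  [/\ forall x, m aVIS x <= sg.+1,
      forall x, m aVIS x = sg -> Reach D a t x (m aCUR x),
      forall x, m aVIS x = sg.+1 -> Reach D a t.+1 x (m aCUR x),
      forall k' c, k' < k -> Reach D a t (keyof D t k') c ->
        m aVIS (keyof D t k') = sg
    & forall k' c, k <= k' < 2 ^ size f -> Reach D a t.+1 (keyof D t k') c ->
        m aVIS (keyof D t k') = sg.+1].

(** The second clause says nothing about [rC]: by the first clause and [Tr_end] it is the end of
    every such trail. *)
Definition pulled (k : nat) (m : memory) : Prop :=
  (m rFND 0 != 0 -> Tr D a t.+1 (keyof D t k) (m rC 0)) /\
  (forall c, Tr D a t.+1 (keyof D t k) c -> m rFND 0 != 0).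

Lemma neq_expr x y : (x - y + (y - x) == 0) = (x == y).
Proof. by rewrite addn_eq0 !subn_eq0 eqn_leq. Qed.

Lemma wp_pull m0 sg k : env D m0 -> loaded D t.+1 m0 -> m0 rT 0 = t.+1 ->
  m0 rSIG 0 = sg -> decoded k m0 -> table sg k.+1 m0 ->
  wp pull m0 (200 + 200 * size f) (pulled k).
Proof.
move=> env0 [hN _ hFL _] hT hS [hY hB _] [_ tS _ tC _].
set y := keyof D t k in hY.
pose n := size f.
have hN' : m0 rN 0 = n by [].
(* The condition under which [pull_edge] succeeds, stated in the initial memory; the loop changes
   neither the table nor the digits. *)
pose good (j : nat) := [&& bit k j, t.+1 \in tms D (nth 0 f j),
   m0 aVIS (y - 2 ^ nth 0 f j) == sg &
   (m0 aCUR (y - 2 ^ nth 0 f j) == src D (nth 0 f j))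
   || (m0 aCUR (y - 2 ^ nth 0 f j) == dst D (nth 0 f j))].
pose I i (m : memory) := [/\ m rJJ 0 = i,
   m rFND 0 != 0 -> Tr D a t.+1 y (m rC 0),
   m0 aVIS y = sg -> m rFND 0 != 0
   & forall j, j < i -> good j -> m rFND 0 != 0].
apply: (@wp_seq _ _ _ 40 (200 * size f + 50)); last lia.
apply: wp_flat => //; set m1 := (X in wp _ X).
apply: (@wp_while_const _ _ n I 160).
- rewrite /I /m1 /=; upd; rewrite neq_expr hY hS.
  have [vy|/eqP nvy] := eqVneq (m0 aVIS y) sg; upd; split=> //.
  by move=> _; apply/TrS; left; case: (tS _ vy).
- move=> i m lt fr1 [hJ h1 h2 h3].
  have fr b : b \notin [:: rJJ; rFND; rC; rD] -> m b = m0 b.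
    move=> hb; transitivity (m1 b); first by apply: fr1; apply: notin_sub hb.
    by apply: sem_frame; apply: notin_sub hb.
  have env2 : env D m by apply: (env_frame env0); rewrite fr.
  have [he al] := nth_f lt.
  have hF : m aFL i = nth 0 f i by rewrite fr // hFL.
  split; first by rewrite /= hJ fr // hN'; lia.
  apply: wp_flat => //=; rewrite /I; upd.
  rewrite !hJ !(fr aBIT) // hB //.
  rewrite hF (env_OFF env2) // !(fr rT) // hT (env_ACT env2) //.
  have goodS (F : nat) : (good i -> F != 0) -> (m rFND 0 != 0 -> F != 0) ->
      forall j, j < i.+1 -> good j -> F != 0.
    move=> hi hm j; rewrite ltnS leq_eqVlt => /orP[/eqP->//|lj gj].
    exact/hm/(h3 j).
  rewrite /good in goodS; case bk: (bit k i) goodS => /= goodS; last first.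
    upd; rewrite hJ addn1; split=> //; exact: goodS.
  case tt: (t.+1 \in tms D (nth 0 f i)) goodS => /= goodS; last first.
    upd; rewrite hJ addn1; split=> //; exact: goodS.
  upd; rewrite ?hJ ?hF ?(fr aVIS) // ?(fr rSIG) // hS ?(env_W env2) //.
  rewrite ?(fr rY) // hY.
  rewrite !neq_expr ?(fr aCUR) // (env_U env2) // (env_V env2) //.
  set z := y - _ in goodS *.
  have be : bit y (nth 0 f i) by rewrite bit_keyof_nth.
  have use c : m0 aVIS z = sg -> joins D (nth 0 f i) (m0 aCUR z) c ->
      Tr D a t.+1 y c.
    by move=> /tS[tz _] jn; apply/TrS; right; exists (nth 0 f i), (m0 aCUR z).
  have [vz|vz] := eqVneq (m0 aVIS z) sg; last first.
    upd; rewrite hJ addn1; split=> //; apply: goodS => //.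
    by rewrite (negPf vz).
  have [cu|cu] := eqVneq (m0 aCUR z) (src D (nth 0 f i)).
    by upd; rewrite hJ addn1; split=> // _; apply: use => //; left.
  have [cv|cv] := eqVneq (m0 aCUR z) (dst D (nth 0 f i)).
    by upd; rewrite hJ addn1; split=> // _; apply: use => //; right.
  upd; rewrite hJ addn1; split=> //; apply: goodS => //.
  by rewrite (negPf cu) (negPf cv) andbF.
- move=> m fr1 [hJ h1 h2 h3].
  have fr b : b \notin [:: rJJ; rFND; rC; rD] -> m b = m0 b.
    move=> hb; transitivity (m1 b); first by apply: fr1; apply: notin_sub hb.
    by apply: sem_frame; apply: notin_sub hb.
  split; first by rewrite /= hJ fr // hN' subnn.
  split=> // c /TrS[ty|[e [c' [he te be jn tz]]]].
    by apply/h2/(tC k c) => //; split=> //; apply: Full_keyof.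
  have al := tms_alive te.
  have ef : e \in f by rewrite mem_alist he.
  have lt : index e f < size f by rewrite index_mem.
  have ne : nth 0 f (index e f) = e by rewrite nth_index.
  have bk : bit k (index e f) by rewrite -(bit_keyof_nth _ lt) ne.
  apply: (h3 _ lt); rewrite /good bk ne te /=.
  have ky : keyof D t (k - 2 ^ index e f) = y - 2 ^ e.
    by rewrite keyof_sub // ne.
  have vz : m0 aVIS (y - 2 ^ e) = sg.
    rewrite -ky; apply: (tC _ c'); first by rewrite ltnS leq_subr.
    by split; [rewrite ky|apply: Full_keyof].
  (* The entry may stem from another trail with the same edges, but its end is forced to be [c']. *)
  have [tz' _] := tS _ vz; rewrite vz eqxx (Tr_end tz' tz).
  by case: jn => [[-> _]|[-> _]]; rewrite eqxx ?orbT.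
- by rewrite /=; lia.
Qed.

Lemma wp_mask_step m0 sg k : env D m0 -> loaded D t.+1 m0 -> m0 rT 0 = t.+1 ->
  m0 rSIG 0 = sg -> m0 rK 0 = k.+1 -> k < 2 ^ size f -> m0 rX 0 = expired D t ->
  table sg k.+1 m0 ->
  wp mask_step m0 (500 + 300 * size f) (fun m => m rK 0 = k /\ table sg k m).
Proof.
move=> env0 ld hT hS hK ltk hX tb.
apply: (@wp_seq _ _ _ 20 (450 + 300 * size f)); last lia.
apply: wp_flat => //=; rewrite hK subn1 /=; set m1 := (X in wp _ X).
have env1 : env D m1 by apply: (env_frame env0).
have ld1 : loaded D t.+1 m1 by case: ld.
apply: (@wp_seq _ _ _ (100 + 100 * size f) (310 + 200 * size f)); last lia.
apply: (wp_weaken (wp_decode env1 ld1 hT (update_eq _ _ _ _) ltk hX)) => //.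
move=> m2 fr2 dec2.
have env2 : env D m2 by apply: (env_frame env1); rewrite fr2.
have ld2 : loaded D t.+1 m2 by case: ld1 => *; split; rewrite ?fr2.
have hK2 : m2 rK 0 = k by rewrite fr2.
have hT2 : m2 rT 0 = t.+1 by rewrite fr2.
have hS2 : m2 rSIG 0 = sg by rewrite fr2.
have tb2 : table sg k.+1 m2 by case: tb => *; split; rewrite ?fr2.
apply: (@wp_seq _ _ _ (200 + 200 * size f) 100); last lia.
apply: (wp_weaken (wp_pull env2 ld2 hT2 hS2 dec2 tb2)) => //.
move=> m3 fr3 [snd cpl].
have [hY _ hOK] : decoded k m3 by case: dec2 => *; split; rewrite ?fr3.
have hK3 : m3 rK 0 = k by rewrite fr3.
have hS3 : m3 rSIG 0 = sg by rewrite fr3.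
have [b0 b1 b2 b3 b4] : table sg k.+1 m3 by case: tb2 => *; split; rewrite ?fr3.
apply: wp_flat => //=.
(* The case where nothing is written: the new completeness requirement at mask [k] is vacuous. *)
have keep : (forall c, ~ Reach D a t.+1 (keyof D t k) c) ->
    m3 rK 0 = k /\ table sg k m3.
  move=> nr; split=> //; split=> //.
    by move=> k' c lt; apply: b3; apply: ltnW.
  move=> k' c; rewrite leq_eqVlt => /andP[/orP[/eqP<-|lt] lt'] rc.
    by case: (nr c).
  by apply: (b4 k' c) => //; rewrite lt.
case: eqP => [ok0|/eqP ok]; first by apply: keep => c [_ /hOK]; rewrite ok0.
case: eqP => [fn0|/eqP fn]; first by apply: keep => c [/cpl]; rewrite fn0.
rewrite hS3 hY addn1; split; first by upd.
have rk : Reach D a t.+1 (keyof D t k) (m3 rC 0) by split; [exact: snd|exact/hOK].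
split; upd; rewrite ?hY.
- by move=> x; rewrite update_at; case: eqP.
- move=> x; rewrite !update_at; upd; case: eqP => [_ eqs|_ /b1 //].
  by lia.
- by move=> x; rewrite !update_at; upd; case: eqP => [->//|_ /b2].
- move=> k' c lt rc; rewrite update_at ifN; first by apply: (b3 _ c) => //; lia.
  have lt' := ltn_trans lt ltk.
  by apply: contraTneq lt => /keyof_inj->; rewrite ?ltnn.
- move=> k' c /andP[le lt] rc; rewrite update_at; case: eqP => // /eqP ne.
  apply: (b4 _ c) => //; rewrite lt andbT ltn_neqAle le andbT.
  by apply: contra_neq ne => ->.
Qed.
End Mask.

(** * One stage, one start vertex, all start vertices *)

Section Run.
Variable D : instance.
Hypothesis wfD : wf D.

(** The bound on all stamps makes [sg.+1] fresh for the next stage. *)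
Definition frontier (a sg t : nat) (m : memory) : Prop :=
  [/\ m rT 0 = t, m rX 0 = expired D t, m rSIG 0 = sg,
      forall x, m aVIS x <= sg
    & (forall x, m aVIS x = sg -> Reach D a t x (m aCUR x)) /\
      (forall x c, Reach D a t x c -> m aVIS x = sg)].

(** The factor [n.+1] also pays for a stage at which no edge is alive. *)
Definition stage_cost (n : nat) : nat := 2000 * (2 ^ n * n.+1).

Lemma wp_stage a sg t m0 : env D m0 -> frontier a sg t m0 ->
  wp stage m0 (stage_cost (size (alist D (nE D) t.+1)))
    (frontier a sg.+1 t.+1).
Proof.
move=> env0 [hT hX hS hV [snd cpl]].
set f := alist D (nE D) t.+1; set n := size f.
have n2 : 0 < 2 ^ n by rewrite expn_gt0.
have costE : 600 + 200 * n + 2 ^ n * (600 + 300 * n) < stage_cost n.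
  by rewrite /stage_cost; move: n2; move: (2 ^ n) => p; nia.
apply: (@wp_seq _ _ _ 10 (580 + 200 * n + 2 ^ n * (600 + 300 * n))); last lia.
apply: wp_flat => //=; rewrite hT addn1; set m1 := (X in wp _ X).
have env1 : env D m1 by apply: (env_frame env0).
have hT1 : m1 rT 0 = t.+1 by rewrite /m1 update_eq.
apply: (@wp_seq _ _ _ (100 + 100 * n) (400 + 100 * n + 2 ^ n * (600 + 300 * n)));
  last lia.
apply: (wp_weaken (wp_load env1 hT1)) => // m2 fr2 ld2.
have env2 : env D m2 by apply: (env_frame env1); rewrite fr2.
apply: (@wp_seq _ _ _ 10 (380 + 100 * n + 2 ^ n * (600 + 300 * n))); last lia.
have hPW : m2 rPW 0 = 2 ^ n by case: ld2.
apply: wp_flat => //=; rewrite hPW; set m3 := (X in wp _ X).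
have env3 : env D m3 by apply: (env_frame env2).
have ld3 : loaded D t.+1 m3 by case: ld2.
have hT3 : m3 rT 0 = t.+1 by rewrite /m3; upd; rewrite fr2.
have hX3 : m3 rX 0 = expired D t by rewrite /m3; upd; rewrite fr2.
have hS3 : m3 rSIG 0 = sg by rewrite /m3; upd; rewrite fr2.
have vis3 : m3 aVIS = m0 aVIS by rewrite /m3; upd; rewrite fr2.
have cur3 : m3 aCUR = m0 aCUR by rewrite /m3; upd; rewrite fr2.
apply: (@wp_seq _ _ _ (100 + 2 ^ n * (600 + 300 * n)) (200 + 100 * n)); last lia.
apply: (@wp_while_const _ _ (2 ^ n)
  (fun i m => m rK 0 = 2 ^ n - i /\ table D a t sg (2 ^ n - i) m)
  (500 + 300 * n)).
- rewrite subn0; split=> //; split; rewrite ?vis3 ?cur3 //.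
  + by move=> x; apply/leqW.
  + by move=> x eqx; have := hV x; rewrite eqx ltnn.
  + by move=> k' c _; apply: cpl.
  + by move=> k' c; rewrite -/f -/n; lia.
- move=> i m lt fr [hK tb].
  have ek : 2 ^ n - i = (2 ^ n - i.+1).+1 by lia.
  rewrite ek in hK tb; split; first by rewrite /= hK.
  apply: (wp_mask_step wfD) => //; rewrite ?fr //.
  + by apply: (env_frame env3); rewrite fr.
  + by case: ld3 => *; split; rewrite fr.
  + by rewrite -/f -/n; lia.
- move=> m4 fr4; rewrite subnn => -[hK [b0 _ b2 _ b4]].
  split; first by rewrite /= hK.
  have env4 : env D m4 by apply: (env_frame env3); rewrite fr4.
  have [hN _ hFL _] : loaded D t.+1 m4 by case: ld3 => *; split; rewrite fr4.
  have hT4 : m4 rT 0 = t.+1 by rewrite fr4.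
  have hX4 : m4 rX 0 = expired D t by rewrite fr4.
  have hS4 : m4 rSIG 0 = sg by rewrite fr4.
  apply: (@wp_seq _ _ _ 10 (180 + 100 * n)); last lia.
  apply: wp_flat => //=; set m5 := (X in wp _ X).
  have env5 : env D m5 by apply: (env_frame env4).
  apply: (@wp_seq _ _ _ (100 + 100 * n) 20); last lia.
  pose g e := (mxt D e <= t.+1) * 2 ^ e.
  apply: (@wp_while_const _ _ n (fun i m => m rJJ 0 = i /\
    m rX 0 = expired D t + \sum_(j < i) g (nth 0 f j)) 60).
  + by rewrite big_ord0 addn0; split.
  + move=> i m lt fr [hJ hXi]; have [he al] := nth_f lt.
    have envm : env D m by apply: (env_frame env5); rewrite fr.
    have hF : m aFL i = nth 0 f i by rewrite fr //; exact: hFL.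
    have hTm : m rT 0 = t.+1 by rewrite fr.
    split; first by rewrite /= hJ fr // /m5; upd; rewrite hN subn_eq0 -ltnNge.
    apply: wp_flat => //=; rewrite hJ hF (env_MX envm) // hTm big_ord_recr /=.
    have -> : (t.+1 + 1 - mxt D (nth 0 f i) == 0) = ~~ (mxt D (nth 0 f i) <= t.+1).
      by lia.
    rewrite /g; case: (_ <= _) => /=; upd; rewrite hJ addn1 hXi; split=> //.
      by rewrite (env_W envm) // mul1n addnA.
    by rewrite addn0.
  + move=> m fr [hJ hXi]; split.
      by rewrite /= hJ fr // /m5; upd; rewrite hN subnn.
    have visE : m aVIS = m4 aVIS by rewrite fr.
    have curE : m aCUR = m4 aCUR by rewrite fr.
    apply: wp_flat => //=; split; upd; rewrite ?visE ?curE ?(fr rT) ?(fr rSIG) //.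
    * by rewrite hXi (expiredS wfD) (big_nth 0) big_mkord.
    * by rewrite /m5; upd; rewrite hS4 addn1.
    (* A set admissible at [t.+1] contains the edges expired by [t], so it is the key of a mask, and
       by now every mask has been treated. *)
    * split=> // x c rx; have [tx fx] := rx.
      have [k' ltk' xk] := keyof_surj tx (FullS fx).
      by rewrite xk; apply: (b4 _ c); rewrite -?xk.
  + by rewrite /=; lia.
- by rewrite /=; nia.
Qed.

Definition circuit_from (a : nat) : Prop :=
  Tr D a (lamD D) (\sum_(e < nE D) 2 ^ e) a.

Definition run_cost (W : nat) : nat := 100 + lamD D * (10 + stage_cost W).

(** The answer register only ever changes to 1, so it accumulates a disjunction over the starts. The
    stamp bound is returned for the next run. *)
Lemma wp_run a m0 W : env D m0 -> m0 rA 0 = a ->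
  (forall x, m0 aVIS x <= m0 rSIG 0) ->
  (forall t, t < lamD D -> size (alist D (nE D) t.+1) <= W) ->
  wp run m0 (run_cost W)
    (fun m => [/\ forall x, m aVIS x <= m rSIG 0,
       circuit_from a -> m rOUT 0 = 1
     & m rOUT 0 = m0 rOUT 0 \/ m rOUT 0 = 1 /\ circuit_from a]).
Proof.
move=> env0 hA hV hW; rewrite /run_cost.
apply: (@wp_seq _ _ _ 30 (60 + lamD D * (10 + stage_cost W))); last lia.
apply: wp_flat => //; set m1 := (X in wp _ X).
have env1 : env D m1 by apply: (env_frame env0).
pose sg := (m0 rSIG 0).+1.
apply: (@wp_seq _ _ _ (10 + lamD D * (10 + stage_cost W)) 40); last lia.
apply: (@wp_while_const _ _ (lamD D) (fun i m => frontier a (sg + i) i m)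
   (stage_cost W)).
- rewrite /frontier /m1 /= addn0; upd; rewrite (expired0 wfD) hA addn1.
  split=> //.
    by move=> x; rewrite update_at; case: eqP => // _; exact: leqW (hV x).
  split=> [x|x c]; rewrite !update_at; upd.
    case: eqP => [->|_ eqx]; first by split=> //; apply: Full0.
    by have := hV x; rewrite eqx ltnn.
  by move=> [[-> _] _].
- move=> i m lt fr inv.
  have envm : env D m by apply: (env_frame env1); rewrite fr.
  split; first by case: inv => /= -> *; rewrite (env_LAM envm); lia.
  rewrite addnS; apply: (wp_weaken (wp_stage envm inv)) => //.
  have := hW _ lt; set n := size _ => le.
  by rewrite /stage_cost leq_pmul2l // leq_mul ?leq_pexp2l.
- move=> m fr [hT hX hS hVm [snd cpl]].
  have envm : env D m by apply: (env_frame env1); rewrite fr.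
  have hAm : m rA 0 = a by rewrite fr //; exact: hA.
  have hO : m rOUT 0 = m0 rOUT 0 by rewrite fr.
  split; first by rewrite /= hT (env_LAM envm) subnn.
  apply: wp_flat => //=; rewrite !neq_expr hX hS hAm (expired_lam D).
  (* At time [lamD D] all edges have expired, so [rX] addresses the full edge set, and this single
     cell gives the answer. *)
  set x := \sum_(_ < _) _ in hX *.
  have fx : Full D (lamD D) x.
    move=> e he _; rewrite /x (eq_bigr (fun i : 'I__ => true * 2 ^ i)).
      by rewrite (bit_sum _ xpredT) he.
    by move=> i _; rewrite mul1n.
  have [vx|/eqP vx] := eqVneq (m aVIS x) (sg + lamD D).
    have [tx _] := snd _ vx.
    have [cx|/eqP cx] := eqVneq (m aCUR x) a.
      by rewrite cx in tx; upd; rewrite hS; split=> //; right.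
    rewrite hS; split=> //; last by left.
    by move=> h; case: cx; apply: Tr_end tx h.
  rewrite hS; split=> //; last by left.
  by move=> h; case: vx; apply: (cpl x a); split.
- by rewrite /=; lia.
Qed.

Definition endpoint_circuit (e : nat) : Prop :=
  circuit_from (src D e) \/ circuit_from (dst D e).

(** A vertex shared by several listed edges is tried once for each of them; this stays within two
    runs per edge. *)
Lemma wp_starts m0 t1 W : env D m0 -> m0 rT1 0 = t1 ->
  (forall x, m0 aVIS x <= m0 rSIG 0) ->
  (forall t, t < lamD D -> size (alist D (nE D) t.+1) <= W) ->
  wp (Seq (Write rQ (Const 0) (Read aHEAD (Read rT1 (Const 0))))
          (While (Read rQ (Const 0)) start_step))
    m0 (50 + size (alist D (nE D) t1) * (100 + 2 * run_cost W))
    (fun m =>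
      (forall e, e \in alist D (nE D) t1 -> endpoint_circuit e -> m rOUT 0 = 1)
      /\ (m rOUT 0 = m0 rOUT 0 \/ m rOUT 0 = 1 /\
          exists2 e, e \in alist D (nE D) t1 & endpoint_circuit e)).
Proof.
move=> env0 hT1 hV hW; set g := alist D (nE D) t1; set n := size g.
apply: (@wp_seq _ _ _ 10 (30 + n * (100 + 2 * run_cost W))); last lia.
apply: wp_flat => //; set m1 := (X in wp _ X).
have env1 : env D m1 by apply: (env_frame env0).
pose I i (m : memory) := [/\ m rQ 0 = ptr (drop i g),
  forall x, m aVIS x <= m rSIG 0,
  forall j, j < i -> endpoint_circuit (nth 0 g j) -> m rOUT 0 = 1
  & m rOUT 0 = m0 rOUT 0 \/ m rOUT 0 = 1 /\
    exists2 e, e \in g & endpoint_circuit e].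
apply: (@wp_while_const _ _ n I (90 + 2 * run_cost W)).
- split=> //; last by left.
  by rewrite /m1 /=; upd; rewrite hT1 (env_HEAD env0) drop0.
- move=> i m lt fr [hQ hVm hdone hO]; rewrite (ptr_drop lt) in hQ.
  have envm : env D m by apply: (env_frame env1); rewrite fr.
  have hT1m : m rT1 0 = t1 by rewrite fr.
  split; first by rewrite /= hQ.
  have [he al] := nth_f lt; set e := nth 0 g i in hQ he al.
  have eg : e \in g by apply: mem_nth.
  apply: (@wp_seq _ _ _ 10 (70 + 2 * run_cost W)); last lia.
  apply: wp_flat => //=; rewrite hQ subn1 /= (env_U envm) //.
  set m2 := (X in wp _ X).
  have env2 : env D m2 by apply: (env_frame envm).
  apply: (@wp_seq _ _ _ (run_cost W) (60 + run_cost W)); last lia.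
  apply: (wp_weaken (wp_run env2 (update_eq _ _ _ _) hVm hW)) => //.
  move=> m3 fr3 [hV3 hy3 hn3].
  have env3 : env D m3 by apply: (env_frame env2); rewrite fr3.
  have hQ3 : m3 rQ 0 = e.+1 by rewrite fr3.
  apply: (@wp_seq _ _ _ 10 (40 + run_cost W)); last lia.
  apply: wp_flat => //=; rewrite hQ3 subn1 /= (env_V env3) //.
  set m4 := (X in wp _ X).
  have env4 : env D m4 by apply: (env_frame env3).
  apply: (@wp_seq _ _ _ (run_cost W) 30); last lia.
  apply: (wp_weaken (wp_run env4 (update_eq _ _ _ _) hV3 hW)) => //.
  move=> m5 fr5 [hV5 hy5 hn5].
  have env5 : env D m5 by apply: (env_frame env4); rewrite fr5.
  have hQ5 : m5 rQ 0 = e.+1 by rewrite fr5.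
  have hT5 : m5 rT1 0 = t1 by rewrite fr5 // /m4; upd; rewrite fr3.
  have o4 : m4 rOUT 0 = m3 rOUT 0 by [].
  have o2 : m2 rOUT 0 = m rOUT 0 by [].
  rewrite o4 in hn5; rewrite o2 in hn3.
  have keep5 : m3 rOUT 0 = 1 -> m5 rOUT 0 = 1 by case: hn5 => [->|[]].
  have keep3 : m rOUT 0 = 1 -> m3 rOUT 0 = 1 by case: hn3 => [->|[]].
  apply: wp_flat => //=; split; upd => //.
  + rewrite hQ5 hT5 subn1 /= (env_OFF env5) // (env_NEXT env5) //.
    by rewrite /e /g drop_alist.
  + move=> j; rewrite ltnS leq_eqVlt => /orP[/eqP-> [/hy3/keep5//|/hy5//]|lj ec].
    exact/keep5/keep3/(hdone j).
  + case: hn5 => [->|[-> h]]; last by right; split=> //; exists e => //; right.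
    case: hn3 => [->//|[-> h]]; by right; split=> //; exists e => //; left.
- move=> m fr [hQ hVm hdone hO]; split; first by rewrite /= hQ drop_size.
  split=> // e eg ec; apply: (hdone (index e g)); first by rewrite index_mem.
  by rewrite nth_index.
- by rewrite /=; lia.
Qed.

End Run.

(** * Reading the input and building the lists of alive edges *)

Section Parse.
Variable D : instance.
Hypothesis wfD : wf D.

Definition pos (e : nat) : nat := 2 + \sum_(i < e) (3 + size (tms D i)).

Definition input_ok (I : nat -> nat) : Prop :=
  I 1 = nE D /\ forall e, e < nE D ->
  [/\ I (pos e) = src D e, I (pos e + 1) = dst D e,
      I (pos e + 2) = size (tms D e)
    & forall i, i < size (tms D e) -> I (pos e + 3 + i) = nth 0 (tms D e) i].

(** By [par_ACT0] the cells past the parsed blocks are still 0, so inactive times are recorded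
    without any write. [par_T1] starts with the first edge, a minimum over no edges having no
    value. *)
Record parsed (j : nat) (m : memory) : Prop := Parsed {
  par_J : m rJ 0 = j;
  par_POS : m rPOS 0 = pos j;
  par_CUROFF : m rOFF 0 = off D j;
  par_WT : m rWT 0 = 2 ^ j;
  par_U : forall e, e < j -> m aU e = src D e;
  par_V : forall e, e < j -> m aV e = dst D e;
  par_MX : forall e, e < j -> m aMX e = mxt D e;
  par_W : forall e, e < j -> m aW e = 2 ^ e;
  par_OFF : forall e, e < j -> m aOFF e = off D e;
  par_ACT : forall e t, e < j -> t <= mxt D e ->
    m aACT (off D e + t) = (t \in tms D e);
  par_ACT0 : forall d, m aACT (off D j + d) = 0;
  par_HEAD : forall t, m aHEAD t = ptr (alist D j t);
  par_NEXT : forall e t, e < j -> alive D e t ->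
    m aNEXT (off D e + t) = ptr (alist D e t);
  par_LAM : m rLAM 0 = \max_(e < j) mxt D e;
  par_T1 : 0 < j -> (exists2 e, e < j & m rT1 0 = mxt D e) /\
                    forall e, e < j -> m rT1 0 <= mxt D e
}.

Lemma off_lt e t j : e < j -> t <= mxt D e -> off D e + t < off D j.
Proof.
move=> lt le; apply: leq_trans (_ : off D e.+1 <= _).
  by rewrite /off big_ord_recr /= ltn_add2l ltnS.
rewrite /off -!(big_mkord xpredT (fun i => (mxt D i).+1)).
by rewrite (big_cat_nat (n := e.+1) (p := j)) //= leq_addr.
Qed.

Definition scanned (j i : nat) (m : memory) (act : nat -> nat) : Prop :=
  let s := take i (tms D j) in
  [/\ m rI 0 = i, m rPOS 0 = pos j + 3 + i, m rMX 0 = \max_(t <- s) t,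
      0 < i -> m rMN 0 \in s /\ forall t, t \in s -> m rMN 0 <= t
    & (forall d, m aACT (off D j + d) = (d \in s)) /\
      (forall x, x < off D j -> m aACT x = act x)].

Lemma wp_times m0 j : j < nE D -> input_ok (m0 aIN) ->
  m0 rCNT 0 = size (tms D j) -> m0 rOFF 0 = off D j ->
  scanned j 0 m0 (m0 aACT) ->
  wp (While (Defs.Sub (Read rCNT (Const 0)) (Read rI (Const 0))) time_step) m0
    (50 + 100 * size (tms D j))
    (fun m => scanned j (size (tms D j)) m (m0 aACT)).
Proof.
move=> hj [_ /(_ _ hj)[_ _ _ hin]] hC hO inv0; set n := size _ in hC hin *.
apply: (@wp_while_const _ _ n (fun i m => scanned j i m (m0 aACT)) 80) => //.
- move=> i m lt fr [hI hP hM hN [hA1 hA2]].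
  have hCm : m rCNT 0 = n by rewrite fr.
  have hOm : m rOFF 0 = off D j by rewrite fr.
  have hin' : m aIN (pos j + 3 + i) = nth 0 (tms D j) i by rewrite fr // hin.
  split; first by rewrite /= hCm hI subn_eq0 -ltnNge.
  apply: wp_flat => //; rewrite /scanned /=; upd.
  rewrite hP hin' hM hOm (take_nth 0 lt); set tau := nth _ _ _.
  set s := take i _ in hN hA1 hM *.
  have szs : size s = i by rewrite size_takel // ltnW.
  have maxE : \max_(t <- rcons s tau) t = maxn (\max_(t <- s) t) tau.
    by rewrite -cats1 big_cat big_seq1.
  have actE d : update m aACT (off D j + tau) 1 aACT (off D j + d)
      = (d \in rcons s tau).
    rewrite update_at eqn_add2l mem_rcons inE hA1.
    by case: eqP.
  have actE' x : x < off D j -> update m aACT (off D j + tau) 1 aACT x = m0 aACT x.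
    by move=> ltx; rewrite update_at ifN ?hA2 //; lia.
  have mnE b : (b = (m rMN 0 - tau + (1 - i) == 0)) ->
      let v := if b then m rMN 0 else tau in
      0 < i.+1 -> v \in rcons s tau /\ forall t, t \in rcons s tau -> v <= t.
    move=> -> /= _; case: (posnP i) => [i0|ipos].
      have s0 : s = [::] by apply: size0nil; rewrite szs.
      rewrite i0 s0 /= addn_eq0 /= andbF inE eqxx; split=> // t.
      by rewrite inE => /eqP->.
    have [h1 h2] := hN ipos.
    case: ifP => c; split; rewrite ?mem_rcons ?inE ?h1 ?eqxx ?orbT // => t;
      rewrite mem_rcons inE => /orP[/eqP->|/h2]; lia.
  have {mnE} := mnE _ erefl; rewrite maxE.
  have [cm|cm] := eqVneq (tau - \max_(t <- s) t) 0; upd; rewrite ?hI;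
    case: (_ == 0) => /= mnE;
    (upd; rewrite ?hI ?hP ?hM; split=> //;
       [exact: addn1 | by rewrite -addnA addn1 | by lia]).
- move=> m fr inv; split=> //.
  by case: inv => /= -> *; rewrite fr // hC subnn.
- by rewrite /=; lia.
Qed.

Lemma mnt_unique j v : j < nE D -> v \in tms D j ->
  (forall t, t \in tms D j -> v <= t) -> v = mnt D j.
Proof.
by move=> hj vin le; apply/eqP; rewrite eqn_leq le ?mnt_mem //= mnt_le.
Qed.

Definition linked (j i : nat) (m : memory) (head next : nat -> nat) : Prop :=
  [/\ m rT 0 = mnt D j + i,
      forall t, m aHEAD t = if mnt D j <= t < mnt D j + i then j.+1 else head t,
      forall t, mnt D j <= t < mnt D j + i -> m aNEXT (off D j + t) = head t
    & forall x, x < off D j -> m aNEXT x = next x].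

Lemma wp_links m0 j : j < nE D -> m0 rT 0 = mnt D j -> m0 rMX 0 = mxt D j ->
  m0 rOFF 0 = off D j -> m0 rJ 0 = j ->
  wp (While (Defs.Sub (Add (Read rMX (Const 0)) (Const 1)) (Read rT (Const 0)))
        link_step) m0
    (50 + 100 * (mxt D j - mnt D j + 1))
    (fun m => linked j (mxt D j - mnt D j + 1) m (m0 aHEAD) (m0 aNEXT)).
Proof.
move=> hj hT hM hO hJ; set n := _ - _ + 1.
have le := mnt_le_mxt wfD hj.
apply: (@wp_while_const _ _ n
  (fun i m => linked j i m (m0 aHEAD) (m0 aNEXT)) 60) => //.
- split; rewrite ?addn0 //; first by move=> t; rewrite ifN //; lia.
  by move=> t; lia.
- move=> i m lt fr [hTm hH hN1 hN2].
  have hMm : m rMX 0 = mxt D j by rewrite fr.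
  have hOm : m rOFF 0 = off D j by rewrite fr.
  have hJm : m rJ 0 = j by rewrite fr.
  split; first by rewrite /= hMm hTm; lia.
  apply: wp_flat => //=; split; upd; rewrite ?hTm ?hOm ?hJm.
  + by lia.
  + move=> t; rewrite update_at; upd; rewrite hH addn1; case: eqP => [->|ne].
      by rewrite ifT //; lia.
    have -> // : (mnt D j <= t < mnt D j + i.+1) = (mnt D j <= t < mnt D j + i).
    by lia.
  + move=> t ht; rewrite update_at eqn_add2l; case: eqP => [->|ne].
      by rewrite hH ifN //; lia.
    by apply: hN1; lia.
  + by move=> x ltx; rewrite update_at ifN ?hN2 //; lia.
- move=> m fr inv; split=> //.
  by case: inv => /= -> *; rewrite fr // hM; lia.
- by rewrite /=; lia.
Qed.

(** Both inner loops are charged to the interval of the edge: linking runs exactly that long, and by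
    [size_tms] reading the distinct times takes at most as many rounds. *)
Lemma wp_edge m0 j : j < nE D -> input_ok (m0 aIN) -> parsed j m0 ->
  wp edge_step m0 (1000 * (mxt D j - mnt D j + 1)) (parsed j.+1).
Proof.
move=> hj hin par.
have le := mnt_le_mxt wfD hj; have szle := size_tms wfD hj.
have [_ /(_ _ hj)[i0 i1 i2 _]] := hin.
set L := _ - _ + 1 in szle *; set n := size _ in szle i2.
have Lpos : 0 < L by rewrite /L; lia.
apply: (@wp_seq _ _ _ 60 (500 + 200 * L)); last lia.
apply: wp_flat => //; set m1 := (X in wp _ X).
have [hJ hP hO hW hU hV hMX hAW hOF hA hA0 hH hN hL hT1] := par.
apply: (@wp_seq _ _ _ (50 + 100 * L) (400 + 100 * L)); last lia.
have cnt1 : m1 rCNT 0 = n by rewrite /m1 /=; upd; rewrite hP i2.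
have inv1 : scanned j 0 m1 (m1 aACT).
  rewrite /scanned take0 big_nil /m1 /=; upd; split=> //.
  by rewrite hP addn0.
apply: (wp_weaken (wp_times hj hin cnt1 hO inv1)); first by rewrite -/n; lia.
move=> m2 fr2; rewrite /scanned take_size.
move=> [_ hP2 hM2 hN2 [hA2 hA2']].
have {hN2} [|hN2 hN2'] := hN2.
  by have [ne _ _] := wfD hj; rewrite lt0n size_eq0.
have mn2 := mnt_unique hj hN2 hN2'.
apply: (@wp_seq _ _ _ 60 (300 + 100 * L)); last lia.
apply: wp_flat => //; set m3 := (X in wp _ X).
apply: (@wp_seq _ _ _ (50 + 100 * L) 200); last lia.
have hT3 : m3 rT 0 = mnt D j by rewrite /m3 /=; upd.
have hM3 : m3 rMX 0 = mxt D j by rewrite /m3 /=; upd.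
have hO2 : m2 rOFF 0 = off D j by rewrite fr2.
have hJ2 : m2 rJ 0 = j by rewrite fr2.
have hW2 : m2 rWT 0 = 2 ^ j by rewrite fr2.
apply: (wp_weaken (wp_links hj hT3 hM3 hO2 hJ2)) => //.
move=> m4 fr4 [_ hH4 hN4 hN4'].
have hU4 : m4 aU = update m0 aU j (src D j) aU.
  rewrite fr4 // [m3 _]sem_frame // fr2 // /m1 /=; upd.
  by rewrite hJ hP i0.
have hV4 : m4 aV = update m0 aV j (dst D j) aV.
  rewrite fr4 // [m3 _]sem_frame // fr2 // /m1 /=; upd.
  by rewrite hJ hP i1.
have hMX4 : m4 aMX = update m2 aMX j (mxt D j) aMX.
  by rewrite fr4 // /m3 /=; upd; rewrite hJ2 hM2.
have hW4 : m4 aW = update m2 aW j (2 ^ j) aW.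
  by rewrite fr4 // /m3 /=; upd; rewrite hJ2 hW2.
have hOF4 : m4 aOFF = update m2 aOFF j (off D j) aOFF.
  by rewrite fr4 // /m3 /=; upd; rewrite hJ2 hO2.
have hA4 : m4 aACT = m2 aACT by rewrite fr4 // [m3 _]sem_frame.
have hP4 : m4 rPOS 0 = pos j + 3 + n by rewrite fr4 // [m3 _]sem_frame.
have hO4 : m4 rOFF 0 = off D j by rewrite fr4 // [m3 _]sem_frame.
have hW4' : m4 rWT 0 = 2 ^ j by rewrite fr4 // [m3 _]sem_frame.
have hJ4 : m4 rJ 0 = j by rewrite fr4 // [m3 _]sem_frame.
have hM4 : m4 rMX 0 = mxt D j by rewrite fr4.
have hL4 : m4 rLAM = m0 rLAM.
  by rewrite fr4 // [m3 _]sem_frame // fr2 // [m1 _]sem_frame.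
have hT4 : m4 rT1 = m0 rT1.
  by rewrite fr4 // [m3 _]sem_frame // fr2 // [m1 _]sem_frame.
have offS : off D j.+1 = off D j + (mxt D j + 1).
  by rewrite /off big_ord_recr /= addn1.
have head3 : m3 aHEAD = m0 aHEAD.
  by rewrite [m3 _]sem_frame // fr2 // [m1 _]sem_frame.
have next3 : m3 aNEXT = m0 aNEXT.
  by rewrite [m3 _]sem_frame // fr2 // [m1 _]sem_frame.
have act1 : m1 aACT = m0 aACT by rewrite [m1 _]sem_frame.
have frm2 b : b \in [:: aMX; aW; aOFF] -> m2 b = m0 b.
  by rewrite !inE => /or3P[] /eqP->; rewrite fr2 // [m1 _]sem_frame.
have arrS (F G : nat -> nat) (v : nat) :
    (forall e, e < j -> F e = G e) -> v = G j ->
    forall e, e < j.+1 -> (if e == j then v else F e) = G e.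
  by move=> h hv e; rewrite ltnS leq_eqVlt; case: eqP => [->|_ /= /h].
apply: wp_flat => //.
set m5 := sem _ _.
have fr5 b : b \notin writes edge_done -> m5 b = m4 b by apply: sem_frame.
have [J5 O5 W5 L5 T5] : [/\ m5 rJ 0 = j.+1, m5 rOFF 0 = off D j.+1,
    m5 rWT 0 = 2 ^ j.+1, m5 rLAM 0 = maxn (m0 rLAM 0) (mxt D j)
  & m5 rT1 0 = if m0 rT1 0 - mxt D j + (1 - j) == 0 then m0 rT1 0 else mxt D j].
  rewrite /m5 /=; upd; rewrite hM4 hL4.
  have [c1|c1] := eqVneq (mxt D j - m0 rLAM 0) 0; upd; rewrite hT4 hM4 hJ4;
  case: (_ == 0); upd; rewrite hJ4 hO4 hW4' ?hM4 ?hL4 ?hT4 offS addn1 expnS;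
  by split=> //; lia.
split; rewrite ?J5 ?O5 ?W5 ?L5 //.
- by rewrite fr5 // hP4 /pos big_ord_recr /= -/n; lia.
- by rewrite fr5 // hU4 => e; rewrite update_at; apply: arrS e.
- by rewrite fr5 // hV4 => e; rewrite update_at; apply: arrS e.
- rewrite fr5 // hMX4 => e; rewrite update_at frm2 //; exact: arrS e.
- rewrite fr5 // hW4 => e; rewrite update_at frm2 //; exact: arrS e.
- rewrite fr5 // hOF4 => e; rewrite update_at frm2 //; exact: arrS e.
- move=> e t; rewrite fr5 // hA4 ltnS leq_eqVlt => /orP[/eqP->|lt] let'.
    by rewrite hA2.
  by rewrite hA2' ?off_lt // act1 hA.
(* The next block begins one past the last time of edge [j], so no mark of that edge lies in it. *)
- move=> d; rewrite fr5 // hA4 offS -addnA hA2.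
  case: (boolP (_ \in _)) => // /mxt_ge; lia.
- move=> t; rewrite fr5 // hH4 head3 hH /= /alive.
  have -> : (mnt D j <= t < mnt D j + L) = (mnt D j <= t <= mxt D j).
    by rewrite /L; lia.
  by case: ifP.
- move=> e t; rewrite fr5 // ltnS leq_eqVlt => /orP[/eqP->|lt] /andP[al1 al2].
    by rewrite hN4 ?head3 ?hH // /L; lia.
  by rewrite hN4' ?off_lt // next3 hN // /alive al1.
- by rewrite big_ord_recr /= hL.
- move=> _; rewrite T5; case: (posnP j) => [j0|jpos].
    rewrite j0 /= addn_eq0 andbF; split; first by exists 0.
    by move=> e; rewrite ltnS leqn0 => /eqP->.
  have [[e lte eqe] hle] := hT1 jpos.
  case: eqP => c; split.
  + by exists e => //; apply: ltnW.
  + move=> e'; rewrite ltnS leq_eqVlt => /orP[/eqP->|/hle//]; lia.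
  + by exists j.
  + move=> e'; rewrite ltnS leq_eqVlt => /orP[/eqP->//|/hle]; lia.
Qed.

Lemma wp_parse m0 : input_ok (m0 aIN) ->
  (forall b i, b != aIN -> b != rOUT -> m0 b i = 0) ->
  wp parse m0 (100 + 1100 * \sum_(e < nE D) (mxt D e - mnt D e + 1))
    (parsed (nE D)).
Proof.
move=> hin z0; set S := \sum_(_ < _) _.
apply: (@wp_seq _ _ _ 20 (60 + 1100 * S)); last lia.
apply: wp_flat => //; set m1 := (X in wp _ X).
apply: (@wp_while _ _ (nE D) parsed
  (fun e => 1000 * (mxt D e - mnt D e + 1))).
- have z1 b i : b \notin [:: aIN; rOUT; rPOS; rWT] -> m1 b i = 0.
    move=> hb; have -> : m1 b = m0 b by apply: sem_frame; apply: notin_sub hb.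
    by move: hb; rewrite !inE !negb_or => /and4P[h1 h2 _ _]; apply: z0.
  have pos0 : m1 rPOS 0 = pos 0 by rewrite /pos big_ord0.
  by split=> //; rewrite ?/off ?big_ord0 => *; rewrite ?z1.
- move=> i m lt fr par.
  have inm : m aIN = m0 aIN by rewrite fr.
  split; last by apply: wp_edge => //; rewrite inm.
  by have [inE _] := hin; rewrite /= (par_J par) inm inE subn_eq0 -ltnNge.
- move=> m fr par; split=> //=.
  by have [inE _] := hin; rewrite /= (par_J par) fr // [m1 _ 1]inE subnn.
- rewrite /=.
  have -> : \sum_(i < nE D) (1000 * (mxt D i - mnt D i + 1) + 5 + 1) =
      1000 * S + nE D * 6.
    under eq_bigr do rewrite -addnA.
    by rewrite big_split /= sum_nat_const card_ord -big_distrr.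
  have : nE D <= S.
    rewrite -[leqLHS]card_ord -sum1_card; apply: leq_sum => i _; lia.
  by lia.
Qed.

Lemma parsed_env m : parsed (nE D) m -> env D m.
Proof.
case=> hJ hP hO hW hU hV hMX hAW hOF hA hA0 hH hN hL hT1; split=> //.
by move=> e t he /andP[_ le]; apply: hA.
Qed.

End Parse.

(** * Choice of the start vertices and total cost *)

Section Main.
Variable D : instance.
Hypothesis wfD : wf D.

(** The witness is the first edge with its time: all other edges are used later, hence expire no
    earlier than [tau]. The recursion peels edges off the end until this one remains. *)
Lemma Tr_first a t x c : Tr D a t x c -> x <> 0 ->
  exists e tau, [/\ bit x e, src D e = a \/ dst D e = a, tau \in tms D e,
    tau <= t & forall e', bit x e' -> tau <= mxt D e'].
Proof.
elim: t x c => [|t IH] x c; first by move=> [].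
move=> /TrS[tx /(IH _ _ tx)[e [tau [h1 h2 h3 h4 h5]]]|].
  by exists e, tau; split=> //; apply: leqW.
move=> [e [c' [he te be jn tx']]] _; have le := mxt_ge te.
have [x'0|/eqP x'n0] := eqVneq (x - 2 ^ e) 0.
  exists e, t.+1; split=> //.
    have -> : a = c'.
      by rewrite x'0 in tx'; apply: (Tr_end (t := 0) _ tx'); split.
    by case: jn => -[-> _]; [left|right].
  move=> e' be'; suff -> : e' = e by [].
  apply/eqP; have := bit_sub_exp e' be.
  by rewrite x'0 bit0 be'; case: eqP.
have [e1 [tau [h1 h2 h3 h4 h5]]] := IH _ _ tx' x'n0.
exists e1, tau; split=> //.
- by move: h1; rewrite bit_sub_exp // => /andP[].
- exact: leqW.
- move=> e' be'; have [->|ne] := eqVneq e' e; first exact: leq_trans (leqW h4) le.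
  by apply: h5; rewrite bit_sub_exp // be'.
Qed.

Lemma circuit_start a t1 : 0 < nE D ->
  (exists2 e, e < nE D & t1 = mxt D e) ->
  (forall e, e < nE D -> t1 <= mxt D e) ->
  circuit_from D a ->
  exists2 e, e \in alist D (nE D) t1 & endpoint_circuit D e.
Proof.
move=> npos [e0 he0 ->] hmin ca.
have full e : bit (\sum_(i < nE D) 2 ^ i) e = (e < nE D).
  rewrite (eq_bigr (fun i : 'I__ => true * 2 ^ i)).
    by rewrite (bit_sum _ xpredT) andbT.
  by move=> i _; rewrite mul1n.
have [|e [tau [be ends te _ hle]]] := Tr_first ca.
  by move=> x0; have := full 0; rewrite x0 bit0 npos.
rewrite full in be; exists e; last by case: ends => <- in ca; [left|right].
rewrite mem_alist be /alive hmin // andbT (leq_trans (mnt_le te)) //.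
by apply: hle; rewrite full.
Qed.

Lemma size_alist t : size (alist D (nE D) t) = \sum_(e < nE D) alive D e t.
Proof.
rewrite -sum1_size (sum_alist _ _ _ (fun=> 1)).
by apply: eq_bigr => e _; rewrite muln1.
Qed.

Lemma alive_count e : e < nE D ->
  mxt D e - mnt D e + 1 <= \sum_(t < lamD D) alive D e t.+1.
Proof.
move=> he; have le := mnt_le_mxt wfD he; have pos := mnt_gt0 wfD he.
have lel : mxt D e <= lamD D by exact: (leq_bigmax (Ordinal he)).
rewrite -(big_mkord xpredT (fun t => nat_of_bool (alive D e t.+1))).
(* The summand at [t] concerns time [t.+1], so the interval corresponds to [t] from [(mnt D e).-1]
   up to, but excluding, [mxt D e]. *)
rewrite (big_cat_nat (n := (mnt D e).-1)) //=; last by lia.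
rewrite (big_cat_nat (m := (mnt D e).-1) (n := mxt D e)) //=; last by lia.
set A := \sum_(0 <= _ < _) _; set C := \sum_(mxt D e <= _ < _) _.
rewrite (eq_big_nat _ _ (F2 := fun=> 1)); last first.
  by move=> t ht; rewrite /alive; have -> : mnt D e <= t.+1 <= mxt D e by lia.
by rewrite sum_nat_const_nat muln1; lia.
Qed.

(** Double counting of the pairs of an edge and a time at which it is alive; this bounds the cost of
    parsing. *)
Lemma sum_lengths W :
  (forall t, t < lamD D -> size (alist D (nE D) t.+1) <= W) ->
  \sum_(e < nE D) (mxt D e - mnt D e + 1) <= lamD D * W.
Proof.
move=> hW.
apply: leq_trans (_ : \sum_(e < nE D) \sum_(t < lamD D) alive D e t.+1 <= _).
  by apply: leq_sum => e _; apply: alive_count.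
rewrite exchange_big /=; have -> : lamD D * W = \sum_(t < lamD D) W.
  by rewrite sum_nat_const card_ord.
by apply: leq_sum => t _; rewrite -size_alist hW.
Qed.

Lemma wp_euler_prog (m0 : memory) W : input_ok D (m0 aIN) ->
  (forall b i, b != aIN -> m0 b i = 0) ->
  (forall t, t < lamD D -> size (alist D (nE D) t.+1) <= W) ->
  wp euler_prog m0 (500 + 1100 * (lamD D * W) + W * (100 + 2 * run_cost D W))
    (fun m => m rOUT 0 = 1 /\
                (if nE D == 0 then is_true (0 < m0 aIN 0)
                 else exists e, e < nE D /\ endpoint_circuit D e) \/
              m rOUT 0 = 0 /\
                (if nE D == 0 then m0 aIN 0 = 0
                 else forall a, ~ circuit_from D a)).
Proof.
move=> hin z0 hW; set R := W * _.
have Sle := sum_lengths hW; set S := \sum_(_ < _) _ in Sle.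
have [nin _] := hin.
apply: (@wp_seq _ _ _ 50 (400 + 1100 * (lamD D * W) + R)); last lia.
apply: wp_flat => //; set m1 := (X in wp _ X).
have out1 : m1 rOUT 0 = (nE D == 0) && (0 < m0 aIN 0).
  rewrite /m1 /= nin; case: eqP => /= _; last by rewrite z0.
  by rewrite eqn0Ngt; case: posnP => //= _; upd; rewrite ?z0.
have fr1 b : b \notin [:: rOUT] -> m1 b = m0 b.
  by move=> hb; apply: sem_frame; apply: notin_sub hb.
have hin1 : input_ok D (m1 aIN) by rewrite fr1.
have z1 b i : b != aIN -> b != rOUT -> m1 b i = 0.
  by move=> h1 h2; rewrite fr1 ?inE // z0.
apply: (@wp_seq _ _ _ (100 + 1100 * S) (100 + R)); last lia.
apply: (wp_weaken (wp_parse wfD hin1 z1)) => // m2 fr2 par.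
have env2 := parsed_env par.
have hV2 x : m2 aVIS x <= m2 rSIG 0 by rewrite !fr2 // !z1.
have out2 : m2 rOUT 0 = m1 rOUT 0 by rewrite fr2.
(* [hW] covers positive times only; if there are edges, [rT1] is the last time of one of them and
   thus positive. *)
have sz1 : size (alist D (nE D) (m2 rT1 0)) <= W.
  case: (posnP (nE D)) => [-> //|npos].
  have [[e he ->] _] := par_T1 par npos.
  have := mnt_gt0 wfD he; have := mnt_le_mxt wfD he.
  have : mxt D e <= lamD D by exact: (leq_bigmax (Ordinal he)).
  by case: (mxt D e) => [|t]; [lia|move=> lt _ _; apply: hW].
apply: (wp_weaken (wp_starts wfD env2 erefl hV2 hW)).
  apply: leq_add => //; exact: leq_mul.
move=> m fr [hy hn]; move: hn; rewrite out2 out1.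
case: (posnP (nE D)) => [n0|npos].
  rewrite n0 /= => -[->|[_ [e]]//].
  by case: posnP => h; [right|left].
move=> /= -[o0|[-> [e he ee]]].
  right; split=> // a ca.
  have [hex hall] := par_T1 par npos.
  have [e he ee] := circuit_start npos hex hall ca.
  by have := hy e he ee; rewrite o0.
left; split=> //; exists e; split=> //.
by move: he; rewrite mem_alist => /andP[].
Qed.

(** With an edge present, [W], [2 ^ W] and the lifetime are at least 1, so every term is at most the
    product on the right; the coefficients add up to 9920. *)
Lemma euler_cost W : 0 < nE D ->
  (forall t, t < lamD D -> size (alist D (nE D) t.+1) <= W) ->
  500 + 1100 * (lamD D * W) + W * (100 + 2 * run_cost D W)
  <= 20 * 1000 * (W ^ 3 * 2 ^ W * lamD D).
Proof.
move=> npos hW.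
have lpos : 0 < lamD D.
  apply: leq_trans (_ : mxt D 0 <= _); last exact: (leq_bigmax (Ordinal npos)).
  exact: leq_trans (mnt_gt0 wfD npos) (mnt_le_mxt wfD npos).
have Wpos : 0 < W.
  rewrite lt0n; apply/eqP => W0; have := sum_lengths hW; rewrite W0 muln0.
  by rewrite leqn0 sum_nat_eq0 => /forallP/(_ (Ordinal npos)); rewrite addn1.
rewrite /run_cost /stage_cost.
have Ppos : 0 < 2 ^ W by rewrite expn_gt0.
move: (lamD D) (2 ^ W) lpos Ppos => L P lpos Ppos {hW}.
have -> : W ^ 3 = W * (W * W) by [].
pose X := W * (W * W) * P * L.
have h1 : W * (W * (P * L)) <= X by rewrite /X; nia.
have h2 : W * (P * L) <= W * (W * (P * L)) by nia.
have h3 : W * L <= W * (P * L) by nia.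
have h4 : W <= W * L by nia.
rewrite -/X.
have -> : W * (100 + 2 * (100 + L * (10 + 2000 * (P * W.+1)))) =
  300 * W + 20 * (W * L) + 4000 * (W * (W * (P * L))) + 4000 * (W * (P * L)).
  by nia.
have : L * W = W * L by rewrite mulnC.
by lia.
Qed.

End Main.

(** * Temporal graphs as instances *)

Lemma set2_eq (T : finType) (x y u v : T) :
  [set x; y] = [set u; v] -> (u = x /\ v = y) \/ (v = x /\ u = y).
Proof.
move=> /setP h.
have hx : (x == u) || (x == v) by have := h x; rewrite !inE eqxx.
have hy : (y == u) || (y == v) by have := h y; rewrite !inE eqxx orbT.
have hu : (u == x) || (u == y) by have := h u; rewrite !inE eqxx.
have hv : (v == x) || (v == y) by have := h v; rewrite !inE eqxx orbT.
by case/orP: hx => /eqP ex; case/orP: hy => /eqP ey; subst; rewrite ?orbb in hu hv;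
  [left|left|right|left]; rewrite ?(eqP hu) ?(eqP hv).
Qed.

Lemma nth_flatten_sum (cs : seq (seq nat)) e r : r < size (nth [::] cs e) ->
  nth 0 (flatten cs) (\sum_(i < e) size (nth [::] cs i) + r)
  = nth 0 (nth [::] cs e) r.
Proof.
elim: cs e => [|c cs IH] [|e] //= lt; rewrite nth_cat.
  by rewrite big_ord0 lt.
by rewrite big_ord_recl /= -addnA ltnNge leq_addr /= addKn IH.
Qed.

Lemma bit_seq_sum (l : seq nat) j : uniq l ->
  bit (\sum_(i <- l) 2 ^ i) j = (j \in l).
Proof.
elim: l j => [|i l IH] j /=; first by rewrite big_nil bit0.
move=> /andP[ni ul]; rewrite big_cons addnC bit_add_exp ?IH ?(negPf ni) //.
by rewrite inE orbC.
Qed.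

Section Bridge.
Variables (V : finType) (G : temporal_graph V).
Variables (label : V -> 'I_#|V|) (bs : seq (V * V * seq nat)).
Hypothesis label_inj : injective label.
Let ES := [seq [set b.1.1; b.1.2] | b <- bs].
Hypothesis ES_perm : perm_eq ES (enum (edges G)).
Hypothesis ES_times :
  forall b, b \in bs -> perm_eq b.2 (times G [set b.1.1; b.1.2]).

Definition instance_of : instance := {|
  nE := size bs;
  src := nth 0 [seq val (label b.1.1) | b <- bs];
  dst := nth 0 [seq val (label b.1.2) | b <- bs];
  tms := nth [::] [seq b.2 | b <- bs] |}.
Let D := instance_of.
Let es := nth set0 ES.

Lemma blockP e : e < size bs -> exists b, [/\ b \in bs,
  src D e = label b.1.1, dst D e = label b.1.2, tms D e = b.2
  & es e = [set b.1.1; b.1.2]].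
Proof.
rewrite /D /instance_of /es /ES /=; case: bs => // b0 bs' he.
exists (nth b0 (b0 :: bs') e); rewrite mem_nth //.
by split=> //; rewrite [LHS](nth_map b0).
Qed.

Lemma uniq_ES : uniq ES.
Proof. by rewrite (perm_uniq ES_perm) enum_uniq. Qed.

Lemma mem_ES e : (e \in ES) = (e \in edges G).
Proof. by rewrite (perm_mem ES_perm) mem_enum. Qed.

Lemma size_ES : size ES = size bs.
Proof. exact: size_map. Qed.

Lemma es_edge e : e < size bs -> es e \in edges G.
Proof. by move=> he; rewrite -mem_ES mem_nth ?size_ES. Qed.

Lemma tms_perm e : e < size bs -> perm_eq (tms D e) (times G (es e)).
Proof. by move=> /blockP[b [hb _ _ -> ->]]; apply: ES_times. Qed.

Lemma mem_tms e t : e < size bs -> (t \in tms D e) = (t \in times G (es e)).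
Proof. by move=> /tms_perm/perm_mem. Qed.

Lemma wf_instance : wf D.
Proof.
move=> e he; have hp := tms_perm he; have ee := es_edge he; split.
- apply: contra (times_neq0 ee) => /eqP e0; rewrite e0 perm_sym in hp.
  move/perm_nilP: hp => hp; apply/eqP/fsetP => t.
  by rewrite [LHS](_ : _ = (t \in (times G (es e) : seq nat))) // hp inE.
- by rewrite (perm_uniq hp) fset_uniq.
- by apply/allP => t; rewrite mem_tms //; apply: times_gt0.
Qed.

Lemma mxt_max e : e < size bs -> mxt D e = max_time G (es e).
Proof. by move=> /tms_perm hp; rewrite /mxt (perm_big _ hp). Qed.

Lemma mnt_min e : e < size bs -> mnt D e = min_time G (es e).
Proof.
move=> he; apply/eqP; rewrite eqn_leq; apply/andP; split.
  have := big_minn_mem (times G (es e)) (max_time G (es e)).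
  rewrite -/(min_time G (es e)) inE => /orP[/eqP->|h].
    by rewrite -mxt_max // (mnt_le_mxt wf_instance).
  by apply: mnt_le; rewrite mem_tms.
by apply: big_minn_le; have := mnt_mem wf_instance he; rewrite mem_tms.
Qed.

(** Generic in the operation: [maxn] serves the lifetime, [addn] the count of interval members. *)
Lemma big_edges (op : Monoid.com_law 0) (F : {set V} -> nat) :
  \big[op/0]_(e in edges G) F e = \big[op/0]_(i < size bs) F (es i).
Proof.
by rewrite -big_enum -(perm_big _ ES_perm) (big_nth set0) size_ES big_mkord.
Qed.

Lemma lam_lifetime : lamD D = lifetime G.
Proof.
by rewrite /lifetime big_edges; apply: eq_bigr => e _; apply: mxt_max.
Qed.

Lemma size_alist_members t :
  size (alist D (nE D) t) = #|interval_members G t|.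
Proof.
rewrite size_alist -sum1_card.
under [RHS]eq_bigl => e do rewrite inE.
rewrite big_mkcondr big_edges; apply: eq_bigr => e _.
by rewrite /alive mxt_max // mnt_min //; case: ifP.
Qed.

Lemma size_alist_imw t : t < lamD D -> size (alist D (nE D) t.+1) <= imw G.
Proof.
rewrite lam_lifetime size_alist_members => lt.
have h : t.+1 \in index_iota 1 (lifetime G).+1 by rewrite mem_index_iota.
by rewrite /imw (big_rem _ h) /= leq_maxl.
Qed.

Lemma input_instance : input_ok D
  (input_memory [:: #|V|, size bs & flatten (map (edge_code label) bs)] aIN).
Proof.
set cs := map _ bs; split=> // e he.
have posE : pos D e = (\sum_(i < e) size (nth [::] cs i)).+2.
  rewrite /pos add2n; congr _.+2; apply: eq_bigr => i _.
  have hi : i < size bs by apply: ltn_trans he.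
  rewrite /D /instance_of /cs /=; case: bs hi => // b0 bs' hi.
  by rewrite !(nth_map b0).
have [b [hb hs hd ht _]] := blockP he.
have ce : nth [::] cs e = [:: src D e, dst D e, size (tms D e) & tms D e].
  have he' : e < size bs by [].
  rewrite /D /instance_of /cs /=; case: bs he' => // b0 bs' he'.
  by rewrite !(nth_map b0).
have rd r : r < (size (tms D e)).+3 ->
    input_memory [:: #|V|, size bs & flatten cs] aIN (pos D e + r)
    = nth 0 [:: src D e, dst D e, size (tms D e) & tms D e] r.
  by move=> lt; rewrite posE !addSn /input_memory /= nth_flatten_sum ?ce.
split; rewrite ?rd //.
- by rewrite -[pos D e]addn0 rd.
- by move=> i lt; rewrite -addnA rd.
Qed.

(** * Temporal trails of the graph against [Tr] *)

Lemma walk_rcons x y e l : walk G x y (rcons l e) <->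
  exists z, [/\ walk G x z l, e \in edges G & e = [set z; y]].
Proof.
elim: l x => [|e' l IH] x /=; split.
- by move=> [z [h1 h2 <-]]; exists x.
- by move=> [z [<- h1 h2]]; exists y.
- by move=> [z [h1 h2 /IH[z' [h3 h4 h5]]]]; exists z'; split=> //; exists z.
- move=> [z' [[z [h1 h2 h3]] h4 h5]]; exists z; split=> //.
  by apply/IH; exists z'.
Qed.

Lemma sorted_rcons_ltn (l : seq nat) t :
  sorted ltn (rcons l t) = sorted ltn l && all (fun u => u < t) l.
Proof.
by rewrite !(sorted_pairwise ltn_trans) pairwise_rcons andbC.
Qed.

Lemma joins_set e z y : e < size bs -> es e = [set z; y] ->
  joins D e (label z) (label y).
Proof.
move=> /blockP[b [_ hs hd _ ->]] /esym /set2_eq.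
by rewrite /joins hs hd => -[[-> ->]|[-> ->]]; [left|right].
Qed.

Lemma index_es e : e \in edges G -> index e ES < size bs /\ es (index e ES) = e.
Proof. by rewrite -mem_ES => he; rewrite -size_ES index_mem /es nth_index. Qed.

(** Induction on the last time-edge, as [Tr] recurses; increasing times leave the rest of the walk
    strictly before [tau]. *)
Lemma walk_Tr x y s T : temporal_walk G x y s -> uniq (unzip1 s) ->
  all (fun t => t <= T) (unzip2 s) ->
  Tr D (label x) T (\sum_(p <- s) 2 ^ index p.1 ES) (label y).
Proof.
elim/last_ind: s y T => [|s [e tau] IH] y T.
  by move=> [_ /= <- _] _ _; rewrite big_nil; apply: (@Tr_mono _ _ 0).
rewrite /temporal_walk /unzip1 /unzip2 !map_rcons all_rcons sorted_rcons_ltn.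
move=> [/andP[te al] /walk_rcons[z [wk /= he /= ez]] /andP[st lt]].
rewrite rcons_uniq all_rcons => /andP[/= ni un] /andP[/= leT _].
have [hi ei] := index_es he.
move: te => /andP[_ /= te].
have tpos := times_gt0 he te.
(* The last time is positive, so it is a successor, the form in which [Tr] consumes an edge; from
   here [tau] names its predecessor. *)
case: tau tpos te lt leT => // tau _ te lt leT.
apply: (Tr_mono leT); apply/TrS; right.
have tr : Tr D (label x) tau (\sum_(p <- s) 2 ^ index p.1 ES) (label z).
  by apply: IH => //.
have sumE : \sum_(p <- s) 2 ^ index p.1 ES =
    \sum_(i <- [seq index u ES | u <- unzip1 s]) 2 ^ i.
  by rewrite -map_comp big_map.
have bE j : bit (\sum_(p <- s) 2 ^ index p.1 ES) j
    = (j \in [seq index u ES | u <- unzip1 s]).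
  rewrite sumE bit_seq_sum // map_inj_in_uniq // => u v.
  move=> hu hv euv.
  have sub w : w \in unzip1 s -> w \in ES.
    by move=> /mapP[p hp ->]; rewrite mem_ES; have /andP[] := allP al p hp.
  by rewrite -(nth_index set0 (sub _ hu)) euv nth_index // sub.
(* The edge is new to the walk, so adding its power of two produces no carry. *)
have nb : bit (\sum_(p <- s) 2 ^ index p.1 ES) (index e ES) = false.
  rewrite bE; apply/negP => /mapP[u hu euv].
  have uE : u \in ES.
    by move: hu => /mapP[p hp ->]; rewrite mem_ES; have /andP[] := allP al p hp.
  move: ni; rewrite -(nth_index set0 (x := e) (s := ES)) ?mem_ES //.
  by rewrite euv nth_index // hu.
exists (index e ES), (label z).
rewrite -cats1 big_cat big_seq1 /= addnK; split=> //.
- by rewrite mem_tms // ei.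
- by rewrite bit_add_exp // eqxx orbT.
- by apply: joins_set => //; rewrite ei.
Qed.

(** The correspondence between digits and used edges is carried along because it makes the extended
    walk repeat no edge: digit [e] of [k - 2 ^ e] is 0. *)
Lemma Tr_walk x T k c : Tr D (label x) T k c ->
  exists y s, [/\ c = label y, temporal_walk G x y s, uniq (unzip1 s),
    all (fun t => t <= T) (unzip2 s)
    & forall e, e < size bs -> (es e \in unzip1 s) = bit k e].
Proof.
elim: T k c => [|T IH] k c.
  move=> [-> ->]; exists x, [::]; split=> //.
  by move=> e _; rewrite bit0.
move=> /TrS[/IH[y [s [h1 h2 h3 h4 h5]]]|].
  by exists y, s; split=> //; apply: sub_all h4 => t; apply: leqW.
move=> [e [c' [he te be jn /IH[z [s [c'z [al wk st] un lt hb]]]]]].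
have [b [_ hs hd _ eb]] := blockP he.
have [y cy ey] : exists2 y, c = label y & es e = [set z; y].
  move: jn; rewrite /joins hs hd c'z eb.
  move=> [[/val_inj/label_inj<- <-]|[/val_inj/label_inj<- <-]].
    by exists b.1.2.
  by exists b.1.1 => //; rewrite setUC.
exists y, (rcons s (es e, T.+1)); split=> //.
- rewrite /temporal_walk /unzip1 /unzip2 !map_rcons all_rcons sorted_rcons_ltn.
  split; rewrite ?st //=.
  + by rewrite al andbT /time_edge /= es_edge // -mem_tms.
  + by apply/walk_rcons; exists z; split=> //; apply: es_edge.
- rewrite /unzip1 map_rcons rcons_uniq un andbT.
  by rewrite (hb e he) bit_sub_exp // eqxx andbF.
- rewrite /unzip2 map_rcons all_rcons /= leqnn.
  by apply: sub_all lt => t; apply: leqW.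
- move=> i hi; rewrite /unzip1 map_rcons mem_rcons inE (hb i hi) bit_sub_exp //=.
  rewrite nth_uniq ?size_ES ?uniq_ES //.
  by case: eqP => [->|_]; rewrite ?be ?andbT.
Qed.

Lemma eulerian_instance : 0 < size bs ->
  temporally_eulerian G <-> exists x, circuit_from D (label x).
Proof.
move=> npos; split.
  move=> [s [[x tw] [_ un eqE]]]; exists x.
  have al : all (fun t => t <= lamD D) (unzip2 s).
    apply/allP => t /mapP[p hp ->]; have [al _ _] := tw.
    have /andP[h1 h2] := allP al _ hp.
    have [hi ei] := index_es h1.
    apply: leq_trans (leq_bigmax (Ordinal hi)).
    by rewrite /= mxt_ge // mem_tms // ei.
  have := walk_Tr tw un al; rewrite /circuit_from; congr (Tr _ _ _ _ _).
  have -> : \sum_(p <- s) 2 ^ index p.1 ES =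
    \sum_(i <- [seq index u ES | u <- unzip1 s]) 2 ^ i.
    by rewrite -map_comp big_map.
  (* An Euler circuit lists every edge once, so its indices are a permutation of all indices. *)
  rewrite -(big_mkord xpredT (fun i => 2 ^ i)); apply: perm_big.
  apply: uniq_perm; last 1 first.
  - move=> i; rewrite mem_index_iota /=; apply/mapP/idP.
      by move=> [u hu ->]; rewrite eqE in hu; have [] := index_es hu.
    move=> hi; exists (es i); first by rewrite eqE es_edge.
    by rewrite index_uniq ?size_ES ?uniq_ES.
  - rewrite map_inj_in_uniq // => u v; rewrite !eqE -!mem_ES => hu hv euv.
    by rewrite -(nth_index set0 hu) euv nth_index.
  - exact: iota_uniq.
move=> [x /Tr_walk[y [s [/val_inj/label_inj xy tw un _ hb]]]].
rewrite -xy in tw; exists s; split; first by exists x.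
have [al wk _] := tw; split=> //; first by exists x.
move=> u; apply/idP/idP => [/mapP[p hp ->]|hu].
  by have /andP[] := allP al _ hp.
have [hi <-] := index_es hu; rewrite hb //.
rewrite (eq_bigr (fun i : 'I__ => true * 2 ^ i)); last by move=> i _; rewrite mul1n.
by rewrite (bit_sum _ xpredT) hi.
Qed.

End Bridge.

Theorem theorem4p3 :
  exists (p : prog) (C : nat),
    forall (k : nat) (V : finType) (G : temporal_graph V) (inp : seq nat),
      TempEuler_instance G k ->
      encodes G inp ->
      exists (c : nat) (m : memory),
        [/\ exec p (input_memory inp) c m,
            output m = 1 <-> TempEuler_yes G k,
            output m = 0 <-> ~ TempEuler_yes G k
          & c <= C * maxn 1 (imw G ^ 3 * 2 ^ imw G * lifetime G)].
Proof.
exists euler_prog, (20 * 1000) => k V G inp inst.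
move=> [label [bs [label_inj ES_perm ES_times ->]]].
pose D := instance_of label bs.
have wfD : wf D := wf_instance ES_perm ES_times.
have lamE : lamD D = lifetime G := lam_lifetime label ES_perm ES_times.
have hW t : t < lamD D -> size (alist D (nE D) t.+1) <= imw G.
  exact: size_alist_imw.
have hin := input_instance label bs.
have [//|c [m [ex le post]]] := wp_euler_prog wfD hin _ hW.
  by move=> b i; rewrite /input_memory => /negPf ->.
exists c, m.
have decides : output m = 1 /\ temporally_eulerian G \/
               output m = 0 /\ ~ temporally_eulerian G.
  case: post => -[om]; case: eqP => [n0|/eqP]; rewrite -?lt0n.
  - have E0 : edges G =i pred0.
      move=> e; rewrite -mem_enum -(perm_mem ES_perm).
      by rewrite (size0nil n0).
    move=> Vpos; left; split=> //; exists [::].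
    have /card_gt0P[x _] : 0 < #|V| by [].
    split; first by exists x.
    by split=> [||e]; [exists x| |rewrite E0].
  - move=> npos [e [he ee]]; left; split=> //.
    apply/(eulerian_instance label_inj ES_perm ES_times npos).
    have [b [_ hs hd _ _]] := blockP label he.
    by case: ee; rewrite ?hs ?hd => h; [exists b.1.1|exists b.1.2].
  - move=> V0; right; split=> // -[s [[x _] _]].
    have : #|V| = 0 by [].
    by move=> /card0_eq/(_ x).
  - move=> npos nc; right; split=> //.
    move=> /(eulerian_instance label_inj ES_perm ES_times npos)[x].
    exact: nc.
have yesE : TempEuler_yes G k <-> temporally_eulerian G by split=> [[]|].
split=> //.
- by rewrite yesE; case: decides => -[-> h].
- by rewrite yesE; case: decides => -[-> h]; split.
apply: (leq_trans le); rewrite -lamE.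
(* Without edges the width and the lifetime are 0 and so is the product; [maxn 1] then absorbs the
   constant cost. *)
case: (posnP (nE D)) => [n0|npos].
  have l0 : lamD D = 0.
    by rewrite /lamD n0 big_ord0.
  have -> : imw G = 0 by rewrite /imw -lamE l0 big_geq.
  by rewrite !mul0n muln0 addn0 (leq_trans _ (leq_pmulr _ _)).
apply: (leq_trans (euler_cost wfD npos hW)).
by rewrite leq_mul2l leq_maxr orbT.
Qed.
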